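(* Let $P \subseteq \mathbb{R}^n$ be a rational polyhedron. Then its two-halfspace closure $\mathcal{T}(P)$ is a rational polyhedron.
   Context: For a set $Q\subseteq\mathbb{R}^n$, write $Q_I := \operatorname{conv}(Q\cap\mathbb{Z}^n)$ (the integer hull). A rational polyhedron is a set $\{x\in\mathbb{R}^n : Ax\le b\}$ with $A,b$ having rational (equivalently, integer) entries; a rational halfspace is a set $\{x\in\mathbb{R}^n:\langle a,x\rangle\le \beta\}$ with $a\in\mathbb{Q}^n\setminus\{0\}$, $\beta\in\mathbb{Q}$. The two-halfspace closure of a polyhedron $P\subseteq\mathbb{R}^n$ is $$\mathcal{T}(P)=\bigcap_{\substack{H_1,H_2 \text{ rational halfspaces}\\ \text{such that } P\subseteq H_1\cap H_2}}(H_1\cap H_2)_I .$$ (An intersection over an empty index set is $\mathbb{R}^n$; $H_1=H_2$ is allowed.) *)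

(* Defs.v *)
From mathcomp Require Import all_boot all_order all_algebra archimedean.
From mathcomp Require Import classical_sets reals.

Set Implicit Arguments.
Unset Strict Implicit.
Unset Printing Implicit Defensive.

Import Order.TTheory GRing.Theory Num.Theory.

Local Open Scope ring_scope.
Local Open Scope classical_set_scope.

Section TwoHalfspaceClosure.
Variables (R : realType) (n : nat).
Implicit Types (Q P H : set 'cV[R]_n).

Definition conv Q : set 'cV[R]_n :=
  [set x | exists (k : nat) (l : 'I_k -> R) (p : 'I_k -> 'cV[R]_n),
    [/\ forall i, 0 <= l i,
        \sum_(i < k) l i = 1,
        forall i, Q (p i)
      & x = \sum_(i < k) l i *: p i]].

Definition integer_points : set 'cV[R]_n := [set x | x \is a mxOver Num.int].

Definition integer_hull Q : set 'cV[R]_n := conv (Q `&` integer_points).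

Definition rational_polyhedron P : Prop :=
  exists (m : nat) (A : 'M[rat]_(m, n)) (b : 'cV[rat]_m),
    P = [set x | forall i, (map_mx ratr A *m x) i 0 <= ratr (b i 0)].

Definition rational_halfspace H : Prop :=
  exists (a : 'cV[rat]_n) (beta : rat),
    a != 0 /\ H = [set x | \sum_(i < n) ratr (a i 0) * x i 0 <= ratr beta].

Definition two_halfspace_closure P : set 'cV[R]_n :=
  \bigcap_(H in [set H : set 'cV[R]_n * set 'cV[R]_n |
      [/\ rational_halfspace H.1, rational_halfspace H.2
        & P `<=` H.1 `&` H.2]])
    integer_hull (H.1 `&` H.2).

End TwoHalfspaceClosure.

(* Main.v *)
Require Import Defs.
From mathcomp Require Import all_boot all_order all_algebra archimedean.
From mathcomp Require Import classical_sets reals.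
From mathcomp Require Import boolp.
From mathcomp Require Import zify ring lra.

(** Call an integral cut [c x <= d] good if, for some integral [u] and [g], the
    part of P where [c x >= d + 1] lies in the open strip [g < u x < g + 1].  By
    Farkas' lemma the emptiness of P ∩ {c x >= d + 1, u x <= g}, and that of
    P ∩ {c x >= d + 1, u x >= g + 1}, is witnessed by a single half-space containing
    P, so good cuts hold on the closure.  Conversely H1 ∩ H2 is a planar cone times a
    linear space, and each bounded edge of the hull of its lattice points is a good
    cut: the next parallel lattice line meets the cone in a lattice-free segment,
    which lies between two consecutive lattice points.  Hence the closure is the
    intersection of all good cuts.  Dickson's lemma, applied to the values of
    [u x - g] at the generators of P, leaves finitely many strips; for a fixed strip
    the good cuts are the lattice points of a polyhedron, and those are generated by
    finitely many of them by Gordan's lemma. *)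

Set Implicit Arguments.
Unset Strict Implicit.
Unset Printing Implicit Defensive.

Import Order.TTheory GRing.Theory Num.Theory.

Local Open Scope ring_scope.

(** * Dickson and Gordan lemmas *)

(** Induction on the coordinates. The list for the remaining coordinates also serves each [x] whose
    value in coordinate [i] is at least the maximum over that list; the smaller values form finitely
    many slices, each covered by induction. *)
Lemma dickson (I T : eqType) (phi : I -> T -> nat) (s : seq I) (X : T -> Prop) :
  exists l : seq T, (forall y, y \in l -> X y) /\
    forall x, X x ->
      exists2 y, y \in l & forall i, i \in s -> (phi i y <= phi i x)%N.
Proof.
have em P : (exists x : T, P x) \/ (forall x, ~ P x).
  by case: (EM (exists x, P x)) => [|nP]; [left|right=> x Px; apply: nP; exists x].
elim: s X => [|i s IH] X.
  case: (em X) => [[x0 Xx0]|nX].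
    exists [:: x0]; split=> [y|x _]; first by rewrite inE => /eqP ->.
    by exists x0; rewrite ?inE.
  by exists [::]; split=> // x /nX.
have [l [lX lP]] := IH X.
have slices M : exists l' : seq T, (forall y, y \in l' -> X y) /\
    forall x, X x -> (phi i x < M)%N ->
      exists2 y, y \in l' & forall j, j \in i :: s -> (phi j y <= phi j x)%N.
  elim: M => [|M [l1 [l1X l1P]]]; first by exists [::].
  have [l2 [l2X l2P]] := IH (fun x => X x /\ phi i x = M).
  exists (l1 ++ l2); split=> [y|x Xx].
    by rewrite mem_cat => /orP [/l1X|/l2X []].
  rewrite ltnS leq_eqVlt => /orP [/eqP xM|xM].
    have [y yl2 yx] := l2P x (conj Xx xM).
    exists y; first by rewrite mem_cat yl2 orbT.
    move=> j; rewrite inE => /orP [/eqP ->|/yx //].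
    by rewrite xM (l2X _ yl2).2.
  by have [y yl1 yx] := l1P x Xx xM; exists y => //; rewrite mem_cat yl1.
have [l' [l'X l'P]] := slices (\max_(y <- l) phi i y).
exists (l ++ l'); split=> [y|x Xx].
  by rewrite mem_cat => /orP [/lX|/l'X].
have [xM|Mx] := ltnP (phi i x) (\max_(y <- l) phi i y).
  by have [y yl yx] := l'P x Xx xM; exists y => //; rewrite mem_cat yl orbT.
have [y yl yx] := lP x Xx; exists y; first by rewrite mem_cat yl.
move=> j; rewrite inE => /orP [/eqP ->|/yx //].
exact: leq_trans (leq_bigmax_seq _ yl _) Mx.
Qed.

(** Existence of a Hilbert basis of the cone [B >= 0]: Dickson's lemma on its nonzero elements gives
    [l], and subtracting from [x] an element of [l] below it stays in the cone and lowers the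
    norm. *)
Lemma gordan (V : zmodType) (I J : finType) (B : I -> V -> int)
    (psi : J -> V -> int)
    (addB : forall i, {morph B i : x y / x - y})
    (addpsi : forall j, {morph psi j : x y / x - y})
    (psi_inj : forall x, (forall j, psi j x = 0) -> x = 0) :
  exists l : seq V, (forall h, h \in l -> forall i, 0 <= B i h) /\
    forall x, (forall i, 0 <= B i x) ->
      exists k : 'I_(size l) -> nat, x = \sum_(i < size l) l`_i *+ k i.
Proof.
(* With positive and negative parts recorded separately, each [psi j y] lies between 0 and
   [psi j x], so that the subtraction reduces absolute values exactly. *)
pose phi (o : I + (J + J)) x := match o with
  | inl i => `|B i x|%N
  | inr (inl j) => `|Num.max (psi j x) 0|%N
  | inr (inr j) => `|Num.max (- psi j x) 0|%N end.
have [l [lX lP]] := dickson phi (enum {: I + (J + J)})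
  (fun x => (forall i, 0 <= B i x) /\ x != 0).
exists l; split=> [h /lX [] //|x].
have [d] := ubnP (\sum_j `|psi j x|%N)%N; elim: d x => // d IH x; rewrite ltnS => xd Bx.
have [->|x0] := eqVneq x 0.
  by exists (fun=> 0%N); rewrite big1.
have [y yl yx] := lP x (conj Bx x0).
have {}yx o : (phi o y <= phi o x)%N by apply: yx; rewrite mem_enum.
have [By y0] := lX _ yl.
have psiyx j : (absz (psi j (x - y)%R) + absz (psi j y) = absz (psi j x))%N.
  rewrite addpsi; move: (yx (inr (inl j))) (yx (inr (inr j))); rewrite /phi; lia.
case: (IH (x - y)) => [|i|k xk].
- apply: leq_trans xd; rewrite -(eq_bigr _ (fun j _ => psiyx j)) big_split /=.
  rewrite -[X in (X < _)%N]addn0 ltn_add2l lt0n; apply: contra y0 => /eqP s0.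
  apply/eqP/psi_inj => j; apply/eqP; rewrite -absz_eq0 -leqn0 -s0.
  by rewrite (bigD1 j) //= leq_addr.
- rewrite addB; move: (yx (inl i)) (By i) (Bx i); rewrite /phi; lia.
exists (fun i => (k i + (i == index y l :> nat))%N).
have yl' : (index y l < size l)%N by rewrite index_mem.
under eq_bigr do rewrite mulrnDr.
rewrite big_split /= -xk (bigD1 (Ordinal yl')) //= eqxx mulr1n nth_index //.
rewrite big1 ?addr0 ?subrK // => i /negPf.
by rewrite -val_eqE /= => ->.
Qed.

(** Minimal elements for the slacks [B - beta] form [l0]; subtracting one that lies below [x] leaves
    an element of the recession cone, where [gordan] applies. *)
Lemma gordan_inhomogeneous (V : zmodType) (I J : finType) (B : I -> V -> int)
    (beta : I -> int) (psi : J -> V -> int)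
    (addB : forall i, {morph B i : x y / x - y})
    (addpsi : forall j, {morph psi j : x y / x - y})
    (psi_inj : forall x, (forall j, psi j x = 0) -> x = 0) :
  exists l0 l : seq V,
    [/\ forall h, h \in l0 -> forall i, beta i <= B i h,
        forall h, h \in l -> forall i, 0 <= B i h
      & forall x, (forall i, beta i <= B i x) ->
          exists2 x0, x0 \in l0 &
          exists k : 'I_(size l) -> nat, x = x0 + \sum_(i < size l) l`_i *+ k i].
Proof.
have [l [lB lP]] := gordan addB addpsi psi_inj.
have [l0 [l0X l0P]] := dickson (fun i x => `|B i x - beta i|%N) (enum I)
  (fun x => forall i, beta i <= B i x).
exists l0, l; split=> // x Bx; have [x0 x0l x0x] := l0P x Bx; exists x0 => //.
case: (lP (x - x0)) => [i|k xk]; last by exists k; rewrite -xk addrC subrK.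
rewrite addB; move: (x0x i); rewrite mem_enum => /(_ isT).
move: (l0X _ x0l i) (Bx i); lia.
Qed.


(** * Comparing strips by their values at generators *)

Section SplitDomination.
Variable I : finType.
Implicit Types (k : I -> nat) (a t f g : I -> int).

(** The multiplicities [k] stand for a point of a finitely generated cone, and [a] for the values of
    a linear form at the generators; [t] is the homogenizing coordinate. *)
Definition weigh k a : int := \sum_i a i *+ k i.

Lemma weighD k1 k2 a :
  weigh (fun i => k1 i + k2 i)%N a = weigh k1 a + weigh k2 a.
Proof. by rewrite -big_split; apply: eq_bigr => i _; rewrite mulrnDr. Qed.

Lemma weighMn k m a : weigh (fun i => m * k i)%N a = weigh k a *+ m.
Proof. by rewrite -sumrMnl; apply: eq_bigr => i _; rewrite mulnC mulrnA. Qed.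

Lemma weigh1 j a : weigh (fun i => (i == j) : nat) a = a j.
Proof.
by rewrite /weigh (bigD1 j) //= eqxx mulr1n big1 ?addr0 // => i /negPf ->.
Qed.

Lemma weighB k a c : weigh k (fun i => a i - c i) = weigh k a - weigh k c.
Proof. by rewrite -sumrB; apply: eq_bigr => i _; rewrite mulrnBl. Qed.

Definition clip (t g : int) : int := Num.min (Num.max g 0) t.

(** Values strictly between 0 and [t] agree, and a value [g] below 0 or above [t] is matched by a
    value [g'] at least as far out on that side. *)
Definition split_le (t g g' : int) : Prop :=
  [/\ clip t g = clip t g', Num.max (- g) 0 <= Num.max (- g') 0
    & Num.max (g - t) 0 <= Num.max (g' - t) 0].

Definition outside t g k : Prop := weigh k g <= 0 \/ weigh k t <= weigh k g.

(** A generator with [t i = 0] is a ray. If [f i] were negative, adding many copies of it to an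
    outside point would leave the point outside, on the side given by the sign of [g i], and make
    [f] nonpositive. *)
Lemma outside_ray_ge0 t f g k0 i :
  (forall k, 0 < weigh k t -> outside t g k -> 0 < weigh k f) ->
  0 < weigh k0 t -> outside t g k0 -> t i = 0 -> 0 <= f i.
Proof.
move=> H k0t k0g ti0; rewrite leNgt; apply/negP => fi0.
pose m := (`|weigh k0 t| + `|weigh k0 g| + `|weigh k0 f|)%N.
pose k j := (k0 j + m * (j == i))%N.
have kE a : weigh k a = weigh k0 a + a i * m%:Z.
  by rewrite weighD weighMn weigh1 -mulr_natr natz.
suff: 0 < weigh k f by rewrite kE; nia.
have kt : weigh k t = weigh k0 t by rewrite kE ti0 mul0r addr0.
apply: H; rewrite ?kt // /outside kt kE.
have [gi|gi|->] := ltrgtP (g i) 0; last by rewrite mul0r addr0.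
- by left; nia.
- by right; nia.
Qed.

(** If no generator inside the strip is used, [f] is positive at the used vertices and nonnegative
    at the rays. Otherwise the inside generators are balanced against the left ones to a point where
    [g] is 0; there [g'] is at most 0, so [f] is positive, and the generators left over contribute
    nonnegative amounts. *)
Lemma split_dominated_left t f g g' :
  (forall i, 0 <= t i) -> (forall i, split_le (t i) (g i) (g' i)) ->
  (forall k, 0 < weigh k t -> outside t g' k -> 0 < weigh k f) ->
  forall k, 0 < weigh k t -> weigh k g <= 0 -> 0 < weigh k f.
Proof.
move=> t0 gg' H k kt kg.
have vert i : 0 < t i -> g i <= 0 \/ t i <= g i -> 0 < f i.
  move=> ti gi; rewrite -(weigh1 i f); apply: H; rewrite ?weigh1 //.
  rewrite /outside !weigh1; case: (gg' i) => + + +; rewrite /clip; lia.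
have [[i1 [/andP [gi1 gti1] ki1]]|noin] :=
    EM (exists i, 0 < g i < t i /\ (0 < k i)%N); last first.
  have [i0 ti0 ki0] : exists2 i, 0 < t i & (0 < k i)%N.
    apply/not_exists2P => no; suff: weigh k t <= 0 by lia.
    apply: sumr_le0 => i _; case: (no i) => [|/negP]; last first.
      by rewrite -eqn0Ngt => /eqP ->.
    by move=> /negP; rewrite -leNgt => ti; rewrite mulrn_wle0.
  have out i : (0 < k i)%N -> 0 < t i -> 0 < f i.
    move=> ki ti; apply: vert => //; case: (ltP 0 (g i)) => gi; last by left.
    case: (ltP (g i) (t i)) => gti; last by right.
    by case: noin; exists i; rewrite gi gti.
  have f0 i : (0 < k i)%N -> 0 <= f i.
    move=> ki; have [ti|ti] := ltP 0 (t i); first by rewrite ltW ?out.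
    apply: (outside_ray_ge0 (k0 := fun i => (i == i0) : nat) H).
    - by rewrite weigh1.
    - rewrite /outside !weigh1; case: (gg' i0) => + + +; rewrite /clip.
      case: (ltP 0 (g i0)) => gi; last by lia.
      case: (ltP (g i0) (t i0)) => gti; last by lia.
      by case: noin; exists i0; rewrite gi gti.
    - by apply/eqP; rewrite eq_le ti t0.
  rewrite /weigh (bigD1 i0) //= ltr_pwDl //.
    by rewrite pmulrn_lgt0 // out.
  apply: sumr_ge0 => i _; case: (posnP (k i)) => [->//|/f0 fi].
  by rewrite mulrn_wge0.
pose inn i := 0 < g i < t i; pose lft i := g i < 0.
pose a := \sum_(i | inn i) g i *+ k i.
pose b := \sum_(i | lft i) - g i *+ k i.
have bE : b = - \sum_(i | lft i) g i *+ k i.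
  by rewrite /b -sumrN; apply: eq_bigr => i _; rewrite mulNrn.
have a0 : 0 < a.
  rewrite /a (bigD1 i1) /=; last by rewrite /inn gi1 gti1.
  rewrite ltr_pwDl ?pmulrn_lgt0 // sumr_ge0 // => i /andP [/andP [gi _] _].
  by rewrite mulrn_wge0 // ltW.
have ab : a <= b.
  rewrite -subr_le0; apply: le_trans kg.
  rewrite /weigh (bigID inn) /= -/a lerD2l (bigID lft) /=.
  rewrite -[X in X <= _]addr0 lerD //.
    rewrite bE opprK le_eqVlt; apply/orP; left; apply/eqP; apply: eq_bigl => i.
    by rewrite /inn /lft; lia.
  by apply: sumr_ge0 => i /andP [_]; rewrite /lft -leNgt => /mulrn_wge0 ->.
(* The crossed factors make the value of [g] at [kp] equal to [a * b - b * a]; since [a <= b], no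
   multiplicity exceeds [b] times that of [k]. *)
pose kp i := if inn i then (`|b| * k i)%N else
  if lft i then (`|a| * k i)%N else 0%N.
have kpE c : weigh kp c = \sum_(i | inn i) c i *+ k i * b
    + \sum_(i | lft i) c i *+ k i * a.
  rewrite /weigh (bigID inn) /=; congr (_ + _).
    apply: eq_bigr => i ii; rewrite /kp ii mulnC mulrnA -[LHS]mulr_natr natz.
    by rewrite gez0_abs //; lia.
  rewrite (bigID lft) /= [X in _ + X]big1 ?addr0.
    rewrite (eq_bigl lft) => [|i]; last by rewrite /inn /lft; lia.
    apply: eq_bigr => i li; rewrite /kp li ifF; last first.
      by rewrite /inn; move: li; rewrite /lft; lia.
    by rewrite mulnC mulrnA -[LHS]mulr_natr natz gez0_abs //; lia.
  by move=> i /andP [/negPf ii /negPf li]; rewrite /kp ii li.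
have kpt : 0 < weigh kp t.
  rewrite /weigh (bigD1 i1) //= ltr_pwDl //.
    rewrite pmulrn_lgt0 ?(lt_trans gi1) // /kp /inn gi1 gti1 /= muln_gt0 ki1; lia.
  by apply: sumr_ge0 => i _; rewrite mulrn_wge0.
have kpg : weigh kp g = 0.
  rewrite kpE -!mulr_suml -/a.
  have -> : \sum_(i | lft i) g i *+ k i = - b.
    by rewrite bE opprK.
  by ring.
have kpg' : weigh kp g' <= 0.
  rewrite -kpg; apply: ler_sum => i _; rewrite /kp.
  case: ifP => [|_]; last (case: ifP => //; rewrite /lft => li).
    rewrite /inn => ii; rewrite lerMn2r; apply/orP; right.
    by case: (gg' i) => + + +; rewrite /clip; lia.
  rewrite lerMn2r; apply/orP; right.
  by case: (gg' i) => + + +; rewrite /clip; lia.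
have kpo : outside t g' kp by left.
have kpf := H _ kpt kpo.
suff: 0 < weigh k f *+ `|b|%N by rewrite pmulrn_lgt0 //; lia.
apply: (lt_le_trans kpf); rewrite -weighMn; apply: ler_sum => i _.
rewrite /kp; case: ifP => // ii.
have fi : 0 <= f i.
  have [ti|ti] := ltP 0 (t i).
    by apply/ltW/vert => //; move: ii; rewrite /inn; lia.
  apply: (outside_ray_ge0 H kpt kpo).
  by apply/eqP; rewrite eq_le ti t0.
case: ifP => _; last by rewrite mulr0n mulrn_wge0.
by apply: ler_wpMn2l; rewrite //= leq_mul2r; apply/orP; right; lia.
Qed.

Lemma split_dominated t f g g' :
  (forall i, 0 <= t i) -> (forall i, split_le (t i) (g i) (g' i)) ->
  (forall k, 0 < weigh k t -> outside t g' k -> 0 < weigh k f) ->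
  forall k, 0 < weigh k t -> outside t g k -> 0 < weigh k f.
Proof.
move=> t0 gg' H k kt [kg|kg].
  exact: (split_dominated_left t0 gg' H kt kg).
(* The reflection [t - g] exchanges the two sides of the strip. *)
apply: (@split_dominated_left t f (fun i => t i - g i) (fun i => t i - g' i)) => //.
- by move=> i; move: (t0 i); case: (gg' i); rewrite /split_le /clip; split; lia.
- move=> k' k't [k'g|k'g]; apply: H => //; rewrite /outside; move: k'g;
  rewrite weighB; lia.
- by rewrite weighB; lia.
Qed.

End SplitDomination.

(** * Farkas' lemma *)

Section Farkas.
Variable F : realFieldType.

Lemma between (L U : seq F) :
  (forall l u, l \in L -> u \in U -> l <= u) ->
  exists t, (forall l, l \in L -> l <= t) /\ (forall u, u \in U -> t <= u).
Proof.
elim: L => [_|l L IH LU].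
  elim: U => [|u U [t [_ tU]]]; first by exists 0.
  exists (Num.min t u); split=> // v; rewrite inE => /orP [/eqP ->|/tU tv].
    by rewrite ge_min lexx orbT.
  by rewrite ge_min tv.
have [|t [Lt tU]] := IH.
  by move=> l' u l'L uU; apply: LU; rewrite // inE l'L orbT.
exists (Num.max t l); split=> [l'|u uU].
  rewrite inE => /orP [/eqP ->|/Lt tl]; first by rewrite le_max lexx orbT.
  by rewrite le_max tl.
by rewrite ge_max tU ?LU // mem_head.
Qed.

(** The sign of [a i] decides whether [t] is bounded above or below; the second hypothesis compares
    each lower bound with each upper bound. *)
Lemma solve_one_variable (I : eqType) (s : seq I) (a r : I -> F) :
  (forall i, i \in s -> a i = 0 -> 0 <= r i) ->
  (forall i j, i \in s -> j \in s -> 0 < a i -> a j < 0 ->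
     0 <= - a j * r i + a i * r j) ->
  exists t, forall i, i \in s -> a i * t <= r i.
Proof.
move=> a0 apn.
have [|t [Lt tU]] := @between [seq r i / a i | i <- s & a i < 0]
                         [seq r i / a i | i <- s & 0 < a i].
  move=> _ _ /mapP [j + ->] /mapP [i + ->]; rewrite !mem_filter.
  move=> /andP [aj js] /andP [ai si].
  rewrite ler_ndivrMr // mulrAC ler_pdivrMr //.
  by move: (apn _ _ si js ai aj); lra.
exists t => i si; have [ai|ai|ai] := ltrgtP (a i) 0.
- rewrite mulrC -ler_ndivrMr //; apply: Lt.
  by apply/mapP; exists i; rewrite // mem_filter ai.
- rewrite mulrC -ler_pdivlMr //; apply: tU.
  by apply/mapP; exists i; rewrite // mem_filter ai.
- by rewrite ai mul0r a0.
Qed.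

Variable n : nat.
(** A row [(a, b)] stands for the inequality [a x <= b]; [F^o] makes the right-hand side a module
    element, so that one scaling acts on both components. *)
Notation row := ('cV[F]_n * F^o)%type.
Implicit Types (p : 'cV[F]_n * F^o) (s : seq row) (x : 'cV[F]_n).

Inductive conic s : row -> Prop :=
| conic0 : conic s 0
| conicD c p q : 0 <= c -> p \in s -> conic s q -> conic s (c *: p + q).

Definition dot (a x : 'cV[F]_n) : F := \sum_i a i 0 * x i 0.

Lemma conic_add s p q : conic s p -> conic s q -> conic s (p + q).
Proof.
elim=> [|c p' q' c0 p's _ IH] sq; rewrite ?add0r // -addrA.
by constructor=> //; apply: IH.
Qed.

Lemma conic_scale s c p : 0 <= c -> conic s p -> conic s (c *: p).
Proof.
move=> c0; elim=> [|c' p' q' c'0 p's _ IH]; first by rewrite scaler0; constructor.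
by rewrite scalerDr scalerA; constructor=> //; rewrite mulr_ge0.
Qed.

Lemma conic_mem s p : p \in s -> conic s p.
Proof.
by move=> ps; rewrite -[p]scale1r -[_ *: _]addr0; constructor=> //; constructor.
Qed.

Lemma conic_trans s s' p :
  (forall q, q \in s' -> conic s q) -> conic s' p -> conic s p.
Proof.
move=> s's; elim=> [|c q q' c0 /s's sq _ IH]; first by constructor.
by apply: conic_add => //; apply: conic_scale.
Qed.

(* Fourier-Motzkin elimination: the system [s] only involves the first [k] variables. *)
Lemma farkas_conic k s :
  (forall p (i : 'I_n), p \in s -> (k <= i)%N -> p.1 i 0 = 0) ->
  (forall x, exists2 p, p \in s & p.2 < dot p.1 x) ->
  exists2 b, b < 0 & conic s (0, b).
Proof.
elim: k s => [|k IH] s s0 sx.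
  have [p ps p0] := sx 0; exists p.2.
    by move: p0; rewrite /dot big1 // => i _; rewrite mxE mulr0.
  suff <- : p = (0, p.2) by apply: conic_mem.
  case: p ps {p0} => a b ps; congr pair; apply/colP => i.
  by rewrite mxE; apply: (s0 _ _ ps).
have [kn|nk] := ltnP k n; last first.
  by apply: IH sx => p i ps ki; move: (leq_trans nk ki); rewrite leqNgt ltn_ord.
pose o := Ordinal kn.
(* The rows free of variable [o], and for each pair of opposite signs in [o] the nonnegative
   combination that cancels it. *)
pose s' := [seq p : row <- s | p.1 o 0 == 0] ++
  [seq (- (q : row).1 o 0) *: p + (p : row).1 o 0 *: q |
     p <- [seq p : row <- s | 0 < p.1 o 0],
     q <- [seq q : row <- s | q.1 o 0 < 0]].
have s'P q : q \in s' -> conic s q /\ q.1 o 0 = 0.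
  rewrite mem_cat mem_filter => /orP [/andP [/eqP q0 qs]|].
    by split=> //; apply: conic_mem.
  move=> /allpairsP [[p p'] /=]; rewrite !mem_filter.
  move=> -[/andP [p0 ps] /andP [p'0 p's] ->].
  split; last by rewrite /= !mxE; ring.
  by apply: conic_add; apply: conic_scale; rewrite ?oppr_ge0 ?ltW //; apply: conic_mem.
have [| |b b0 s'b] := IH s'; last first.
- by exists b => //; apply: conic_trans s'b => q /s'P [].
- move=> x; apply/not_exists2P => nx.
  have {}nx q : q \in s' -> dot q.1 x <= q.2.
    by move=> qs; case: (nx q) => // /negP; rewrite -leNgt.
  have dotD a a' : dot (a + a') x = dot a x + dot a' x.
    by rewrite -big_split; apply: eq_bigr => i _; rewrite mxE mulrDl.
  have dotZ c a : dot (c *: a) x = c * dot a x.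
    by rewrite mulr_sumr; apply: eq_bigr => i _; rewrite mxE mulrA.
  (* If [x] satisfied all of [s'], shifting its coordinate [o] by a suitable [t] would satisfy all
     of [s]. *)
  have [| |t tP] := @solve_one_variable _ s
    (fun p : row => p.1 o 0) (fun p : row => p.2 - dot p.1 x).
  + move=> p ps p0; rewrite subr_ge0; apply: nx.
    by rewrite mem_cat mem_filter p0 eqxx ps.
  + move=> p q ps qs p0 q0.
    have : (- q.1 o 0) *: p + p.1 o 0 *: q \in s'.
      rewrite mem_cat; apply/orP; right.
      by apply: allpairs_f; rewrite mem_filter ?p0 ?q0.
    move=> /nx /=; rewrite dotD !dotZ -[_ *: p.2]/(_ * p.2) -[_ *: q.2]/(_ * q.2).
    by move: (p.2 : F) (q.2 : F) => b c; lra.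
  have [p ps] := sx (x + t *: delta_mx o 0); apply/negP; rewrite -leNgt.
  have -> : dot p.1 (x + t *: delta_mx o 0) = dot p.1 x + p.1 o 0 * t.
    rewrite /dot; under eq_bigr do rewrite !mxE mulrDr.
    rewrite big_split /=; congr (_ + _).
    rewrite (bigD1 o) //= !eqxx big1 => [|i /negPf ->]; first by rewrite addr0 mulr1.
    by rewrite !mulr0.
  by move: (tP p ps); lra.
- move=> q i qs; rewrite leq_eqVlt => /orP [/eqP ki|ki].
    suff -> : i = o by have [] := s'P _ qs.
    by apply/val_inj.
  have [+ _] := s'P _ qs; elim=> [|c p q' _ ps _ IHq]; first by rewrite mxE.
  by rewrite /= !mxE (s0 _ _ ps ki) IHq mulr0 addr0.
Qed.

End Farkas.

Lemma farkas (F : realFieldType) (n : nat) (I : finType) (a : I -> 'cV[F]_n)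
    (b : I -> F) :
  (forall x : 'cV[F]_n, exists i, b i < \sum_j a i j 0 * x j 0) ->
  exists lam : I -> F, [/\ forall i, 0 <= lam i,
    \sum_i lam i *: a i = 0 & \sum_i lam i * b i < 0].
Proof.
move=> abx.
have [p i ps||b0 b0lt0] := @farkas_conic F n n [seq (a i, b i : F^o) | i : I].
- by rewrite leqNgt ltn_ord.
- move=> x; have [i bi] := abx x; exists (a i, b i) => //.
  by apply/fintype.imageP; exists i.
move=> cb.
suff: forall p, conic [seq (a i, b i : F^o) | i : I] p ->
    exists lam : I -> F, [/\ forall i, 0 <= lam i,
      \sum_i lam i *: a i = p.1 & \sum_i lam i * b i = p.2].
  by move=> /(_ _ cb) [lam [l0 la lb]]; exists lam; split; rewrite ?lb.
move=> p; elim=> [|c _ q c0 /fintype.imageP [i _ ->] _ [lam [l0 la lb]]].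
  exists (fun=> 0); split=> //; rewrite big1 // => i _; first by rewrite scale0r.
  by rewrite mul0r.
exists (fun j => c * (j == i)%:R + lam j); split=> [j||] /=.
- by rewrite addr_ge0 // mulr_ge0 // ler0n.
- under eq_bigr do rewrite scalerDl.
  rewrite big_split /= la (bigD1 i) //= eqxx mulr1 big1 ?addr0 //.
  by move=> j /negPf ->; rewrite mulr0 scale0r.
- under eq_bigr do rewrite mulrDl.
  rewrite big_split /= lb (bigD1 i) //= eqxx mulr1 big1 ?addr0 //.
  by move=> j /negPf ->; rewrite mulr0 mul0r.
Qed.

(** * Planar cones *)

Section Plane.
Variable R : archiRealFieldType.

(** Think of [m l] as the height of the top lattice point in column [l]. A line through the point of
    column [i] lies above all columns; turning it down until it meets a column to the right gives
    the next hull edge. The walk ends because each step uses up some of the at most [d] columns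
    before [N]. *)
Lemma gift_wrap (m : int -> int) (N : int) (x : R) (d : nat) (i : int) (t : R) :
  N - i <= d%:Z -> i%:~R < x -> x <= N%:~R ->
  (forall l : int, l <= N -> (m l)%:~R <= (m i)%:~R + t * (l%:~R - i%:~R)) ->
  exists (i' j : int) (t' : R), [/\ i' < j <= N, i'%:~R < x <= j%:~R,
    (m j)%:~R = (m i')%:~R + t' * (j%:~R - i'%:~R) &
    forall l : int, l <= N -> (m l)%:~R <= (m i')%:~R + t' * (l%:~R - i'%:~R)].
Proof.
elim: d i t => [|d IH] i t Nid ix xN mt.
  by have := lt_le_trans ix xN; rewrite ltr_int; lia.
have iN : i < N by have := lt_le_trans ix xN; rewrite ltr_int.
pose l (o : 'I_`|N - i|) : int := i + (o : nat)%:Z + 1.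
have lN o : i < l o <= N by rewrite /l; have := ltn_ord o; lia.
have lP (k : int) : i < k -> k <= N -> exists o, k = l o.
  move=> ik kN; have ko : (absz (k - i - 1)%R < absz (N - i)%R)%N by lia.
  by exists (Ordinal ko); rewrite /l /=; lia.
have [o0 _] := lP _ iN (lexx N).
pose slope o : R := ((m (l o))%:~R - (m i)%:~R) / ((l o)%:~R - i%:~R).
case: (@arg_maxP _ _ _ o0 predT slope isT) => o _ omax.
have {}omax o' : slope o' <= slope o := omax o' isT.
have lpos o' : 0 < (l o')%:~R - i%:~R :> R.
  by have [] := andP (lN o'); rewrite subr_gt0 ltr_int.
have slopeE o' : slope o' * ((l o')%:~R - i%:~R) = (m (l o'))%:~R - (m i)%:~R.
  by rewrite divfK // gt_eqF.
have st : slope o <= t.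
  rewrite -(ler_pM2r (lpos o)) slopeE lerBlDl.
  by apply: mt; have [] := andP (lN o).
have mo (k : int) : k <= N -> (m k)%:~R <= (m i)%:~R + slope o * (k%:~R - i%:~R).
  move=> kN; have [ki|ik|->] := ltrgtP k i; last by rewrite subrr mulr0 addr0.
    apply: le_trans (mt k kN) _; rewrite lerD2l.
    by rewrite ler_wnM2r // subr_le0 ler_int ltW.
  have [o' ->] := lP _ ik kN.
  rewrite -lerBlDl -slopeE ler_wpM2r //.
  exact: ltW.
have moE : (m (l o))%:~R = (m i)%:~R + slope o * ((l o)%:~R - i%:~R).
  by rewrite slopeE addrC subrK.
have [lo1 lo2] := andP (lN o).
have [xo|ox] := lerP x (l o)%:~R.
  by exists i, (l o), (slope o); rewrite lN ix xo.
apply: (IH (l o) (slope o)) => //; first by lia.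
move=> k kN; have := mo k kN; rewrite moE; lra.
Qed.

Definition plane_convex (K : R -> R -> Prop) : Prop :=
  forall X Y X' Y' c, K X Y -> K X' Y' -> 0 <= c <= 1 ->
    K (c * X + (1 - c) * X') (c * Y + (1 - c) * Y').

(* A shear [g - j0 * s] that maps the slice [s = 1] into a unit interval maps all
   of [s >= 1] there, because both lattice points of the edge lie in [K]. *)
Lemma edge_split (K : R -> R -> Prop) (i a j b : int) :
  plane_convex K -> i < j -> K i%:~R a%:~R -> K j%:~R b%:~R ->
  (forall l c : int, K l%:~R c%:~R -> (c - a) * (j - i) <= (b - a) * (l - i)) ->
  exists d1 d2 u1 u2 g : int, [/\ 0 < d1, d1 * (b - a) = d2 * (j - i) &
    forall X Y, K X Y ->
      (d1 * a - d2 * i + 1)%:~R <= d1%:~R * Y - d2%:~R * X ->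
      g%:~R < u1%:~R * X + u2%:~R * Y < (g + 1)%:~R].
Proof.
move=> Kc ij Kp Kq Kint.
have [u1 [u2 bez]] := Bezoutz (j - i) (b - a).
pose e := gcdz (j - i) (b - a).
have e0 : 0 < e.
  by rewrite lt_neqAle eq_sym gcdz_eq0 subr_eq0 gt_eqF //= gcdz_ge0.
have [d1 d1E] : exists d1, j - i = d1 * e by exact/dvdzP/dvdz_gcdl.
have [d2 d2E] : exists d2, b - a = d2 * e by exact/dvdzP/dvdz_gcdr.
have ud : u1 * d1 + u2 * d2 = 1.
  apply: (mulIf (lt0r_neq0 e0)); rewrite mul1r -[RHS]bez d1E d2E; ring.
have d10 : 0 < d1 by move: ij; rewrite -subr_gt0 d1E pmulr_lgt0.
have udR : u1%:~R * d1%:~R + u2%:~R * d2%:~R = 1 :> R.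
  by rewrite -!intrM -intrD ud.
pose s (X Y : R) := d1%:~R * (Y - a%:~R) - d2%:~R * (X - i%:~R).
pose g (X Y : R) := u1%:~R * (X - i%:~R) + u2%:~R * (Y - a%:~R).
(* The lattice point next to [(i, a)] on the edge is in [K] by convexity; at these two points [s] is
   0, while [g] is 0 and 1. *)
have Kp' : K (i + d1)%:~R (a + d2)%:~R.
  have := Kc _ _ _ _ (e%:~R^-1) Kq Kp.
  have eR : e%:~R != 0 :> R by rewrite intr_eq0 lt0r_neq0.
  have -> : j = i + d1 * e by rewrite -d1E; ring.
  have -> : b = a + d2 * e by rewrite -d2E; ring.
  rewrite !intrD !intrM.
  have -> (c d : R) : e%:~R^-1 * (c + d * e%:~R) + (1 - e%:~R^-1) * c = c + d.
    by field.
  have -> (c d : R) : e%:~R^-1 * (c + d * e%:~R) + (1 - e%:~R^-1) * c = c + d.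
    by field.
  apply; rewrite invr_ge0 ler0z ltW //= invf_le1 ?ltr0z // -[1]/(1%:~R) ler_int.
  lia.
(* The coordinates [(s, g)] are unimodular, so an integral [g] on the line [s = 1] would give a
   lattice point of [K] beyond the edge. *)
have nolat X Y r : K X Y -> s X Y = 1 -> g X Y <> r%:~R.
  move=> KXY s1 gr.
  have XE : X = (i + r * d1 - u2)%:~R.
    have : X - i%:~R = g X Y * d1%:~R - s X Y * u2%:~R.
      transitivity ((u1%:~R * d1%:~R + u2%:~R * d2%:~R) * (X - i%:~R)).
        by rewrite udR mul1r.
      by rewrite /s /g; ring.
    by rewrite s1 gr mul1r intrB intrD intrM; lra.
  have YE : Y = (a + r * d2 + u1)%:~R.
    have : Y - a%:~R = g X Y * d2%:~R + s X Y * u1%:~R.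
      transitivity ((u1%:~R * d1%:~R + u2%:~R * d2%:~R) * (Y - a%:~R)).
        by rewrite udR mul1r.
      by rewrite /s /g; ring.
    by rewrite s1 gr mul1r !intrD intrM; lra.
  move: KXY; rewrite XE YE => /Kint; rewrite d1E d2E.
  have -> : (a + r * d2 + u1 - a) * (d1 * e) =
    d2 * e * (i + r * d1 - u2 - i) + (u1 * d1 + u2 * d2) * e by ring.
  by rewrite ud mul1r; lia.
(* By convexity [g] takes the slice to an interval; as it misses all integers, it lies between two
   consecutive ones. *)
have slice : exists j0 : int, forall X Y, K X Y -> s X Y = 1 ->
    j0%:~R < g X Y < (j0 + 1)%:~R.
  have [[X0 [Y0 [K0 s0]]]|no] := EM (exists X Y, K X Y /\ s X Y = 1); last first.
    by exists 0 => X Y KXY sXY; case: no; exists X, Y.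
  exists (Num.floor (g X0 Y0)) => X Y KXY sXY.
  have cross (r : int) : ~ (g X Y < r%:~R < g X0 Y0) /\
      ~ (g X0 Y0 < r%:~R < g X Y).
    suff H : g X Y != g X0 Y0 ->
        0 <= (r%:~R - g X0 Y0) / (g X Y - g X0 Y0) <= 1 -> False.
      split=> /andP [h1 h2]; apply: H.
      - by rewrite lt_eqF // (lt_trans h1).
      - have h3 : g X Y - g X0 Y0 < 0 by lra.
        rewrite ler_ndivlMr // mul0r ler_ndivrMr // mul1r; lra.
      - by rewrite gt_eqF // (lt_trans h1).
      - have h3 : 0 < g X Y - g X0 Y0 by lra.
        rewrite ler_pdivlMr // mul0r ler_pdivrMr // mul1r; lra.
    set c := _ / _ => gg c01; have := Kc _ _ _ _ _ KXY K0 c01.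
    move=> /nolat; apply.
      transitivity (c * s X Y + (1 - c) * s X0 Y0); first by rewrite /s; ring.
      by rewrite sXY s0; ring.
    transitivity (c * (g X Y - g X0 Y0) + g X0 Y0); first by rewrite /g; ring.
    by rewrite /c divfK ?subr_eq0 // subrK.
  have := floor_le (g X0 Y0); have := floorD1_gt (g X0 Y0).
  set f := Num.floor _ => f1 f0.
  have [c1 _] := cross f; have [_ c2] := cross (f + 1).
  have n1 := nolat _ _ f KXY sXY; have n2 := nolat _ _ (f + 1) KXY sXY.
  have n3 := nolat _ _ f K0 s0.
  apply/andP; split; rewrite ltNge; apply/negP => h.
    apply: c1; rewrite !lt_neqAle h f0 !andbT.
    by apply/andP; split; apply/eqP => // /esym.
  by apply: c2; rewrite f1 lt_neqAle h andbT; apply/eqP => /esym.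
have [j0 slP] := slice.
exists d1, d2, (u1 + j0 * d2), (u2 - j0 * d1),
  (u1 * i + u2 * a - j0 * (d1 * a - d2 * i)); split=> //.
  by rewrite d2E d1E; ring.
move=> X Y KXY; rewrite !(intrD, intrB, intrM, intrN) => sXY.
have s1 : 1 <= s X Y by rewrite /s; lra.
have sn0 : s X Y != 0 by rewrite gt_eqF //; lra.
(* Weight [1 / s] on [(X, Y)] and the rest on an edge point gives a point of the slice; the first
   edge point yields the lower bound of the sheared form, the second the upper bound. *)
have s01 : 0 <= (s X Y)^-1 <= 1.
  by rewrite invr_ge0 invf_le1 ?s1 ?andbT; lra.
have sg1 : 0 < g X Y - j0%:~R * s X Y.
  have /slP := Kc _ _ _ _ _ KXY Kp s01.
  set w := s _ _; set v := g _ _.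
  have -> : w = 1 by rewrite /w /s; move: sn0; rewrite /s => sn0; field.
  have -> : v = g X Y / s X Y by rewrite /v /g; move: sn0; rewrite /s => sn0; field.
  by move=> /(_ erefl) /andP [+ _]; rewrite ltr_pdivlMr; lra.
have sg2 : g X Y - j0%:~R * s X Y < 1.
  have /slP := Kc _ _ _ _ _ KXY Kp' s01.
  set w := s _ _; set v := g _ _.
  have -> : w = 1.
    by rewrite /w /s !intrD; move: sn0; rewrite /s => sn0; field.
  have -> : v = 1 + (g X Y - 1) / s X Y.
    transitivity (g X Y / s X Y +
        (1 - (s X Y)^-1) * (u1%:~R * d1%:~R + u2%:~R * d2%:~R)).
      by rewrite /v /g !intrD; ring.
    by rewrite udR; field.
  move=> /(_ erefl) /andP [_]; rewrite intrD addrC ltrD2r ltr_pdivrMr; lra.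
move: sg1 sg2; rewrite /s /g => h1 h2; apply/andP; split; lra.
Qed.

Definition wedge (A C : R) (q r : int) (X Y : R) : Prop :=
  X <= A /\ r%:~R * Y + q%:~R * X <= C.

Lemma wedge_convex A C q r : plane_convex (wedge A C q r).
Proof.
move=> X Y X' Y' c [XA YC] [X'A Y'C] /andP [c0 c1].
have c1' : 0 <= 1 - c by rewrite subr_ge0.
split.
  have := lerD (ler_wpM2l c0 XA) (ler_wpM2l c1' X'A); lra.
have := lerD (ler_wpM2l c0 YC) (ler_wpM2l c1' Y'C); lra.
Qed.

(** As [r > 0], the wedge is closed under moving down, so only the upper edge of its lattice hull
    over [X0] matters: the point is on or below it, or [edge_split] makes that edge a good cut which
    the point violates. *)
Lemma wedge_hull_or_cut (A C X0 Y0 : R) (q r : int) :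
  0 < r -> coprimez q r -> X0 <= (Num.floor A)%:~R ->
  (exists (i a j b : int) (c : R), [/\ wedge A C q r i%:~R a%:~R,
     wedge A C q r j%:~R b%:~R, 0 <= c <= 1,
     X0 = c * i%:~R + (1 - c) * j%:~R & Y0 <= c * a%:~R + (1 - c) * b%:~R]) \/
  (exists c1 c2 d u1 u2 g : int, d%:~R < c1%:~R * X0 + c2%:~R * Y0 /\
     forall X Y, wedge A C q r X Y -> (d + 1)%:~R <= c1%:~R * X + c2%:~R * Y ->
       g%:~R < u1%:~R * X + u2%:~R * Y < (g + 1)%:~R).
Proof.
move=> r0 /coprimezP [[v w] /= bez] X0N; set N := Num.floor A in X0N *.
have r0R : 0 < r%:~R :> R by rewrite ltr0z.
pose m l := Num.floor ((C - q%:~R * l%:~R) / r%:~R).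
have mP (l c : int) : l <= N -> (wedge A C q r l%:~R c%:~R <-> c <= m l).
  move=> lN; rewrite /m floor_ge_int ler_pdivlMr //; split=> [[_]|h]; first by lra.
  split; last by lra.
  by apply: le_trans (floor_le A); rewrite ler_int.
have wN (l : int) Y : wedge A C q r l%:~R Y -> l <= N.
  by move=> [lA _]; rewrite floor_ge_int.
have mw (l : int) : l <= N -> wedge A C q r l%:~R (m l)%:~R by move=> lN; apply/mP.
pose M := Num.floor C.
pose T : int := `|Num.floor X0| + `|M * v|.
(* By Bezout, column [k] has a lattice point on the line [r Y + q X = M]; [T] puts the column to the
   left of [X0], and gift wrapping starts with this line. *)
pose k := M * v - r * (T + 1).
have kX0 : k%:~R < X0.
  apply: (@lt_le_trans _ _ (Num.floor X0)%:~R); last exact: floor_le.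
  by rewrite ltr_int /k /T; nia.
have kN : k < N by rewrite -(ltr_int R); apply: lt_le_trans X0N.
have kint (l : int) : l <= N -> r * m l + q * l <= M.
  move=> lN; rewrite floor_ge_int intrD !intrM.
  by have [] := mw l lN.
have mk : r * m k + q * k = M.
  apply: le_anti; rewrite (kint _ (ltW kN)) /=.
  have : M * w + q * (T + 1) <= m k.
    rewrite -(mP _ _ (ltW kN)); split.
      by apply: le_trans (floor_le A); rewrite ler_int ltW.
    apply: le_trans (floor_le C); rewrite -!intrM -intrD ler_int -/M.
    have -> : r * (M * w + q * (T + 1)) + q * k = M * (v * q + w * r).
      by rewrite /k; ring.
    by rewrite bez mulr1.
  move=> h.
  have : M * (v * q + w * r) <= r * m k + q * k.
    have -> : M * (v * q + w * r) = r * (M * w + q * (T + 1)) + q * k.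
      by rewrite /k; ring.
    by rewrite lerD2r ler_wpM2l // ltW.
  by rewrite bez mulr1.
clearbody k.
have start (l : int) : l <= N ->
    (m l)%:~R <= (m k)%:~R + (- q%:~R / r%:~R) * (l%:~R - k%:~R) :> R.
  move=> lN; have := kint l lN; rewrite -mk -(ler_int R) !intrD !intrM => h.
  have tE : (- q%:~R / r%:~R) * r%:~R = - q%:~R :> R by rewrite divfK ?gt_eqF.
  rewrite -(ler_pM2l r0R); set t := _ / _ in tE *.
  have -> (c d : R) : r%:~R * (c + t * d) = r%:~R * c + (t * r%:~R) * d by ring.
  by rewrite tE; lra.
have Nk : N - k <= (absz (N - k)%R)%:Z by lia.
have [i [j [t [/andP [ij jN] /andP [iX Xj] mj ml]]]] :=
  gift_wrap Nk kX0 X0N start.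
have iN : i <= N by rewrite ltW // (lt_le_trans ij).
have ijR : 0 < j%:~R - i%:~R :> R by rewrite subr_gt0 ltr_int.
have edge (l c : int) : wedge A C q r l%:~R c%:~R ->
    (c - m i) * (j - i) <= (m j - m i) * (l - i).
  move=> lc; have lN := wN _ _ lc; have cm : c <= m l by apply/mP.
  rewrite -(ler_int R) !intrM !intrB mj.
  have : c%:~R <= (m i)%:~R + t * (l%:~R - i%:~R) :> R.
    by apply: le_trans (ml l lN); rewrite ler_int.
  by rewrite -lerBlDl => /(ler_wpM2r (ltW ijR)); lra.
pose c := (j%:~R - X0) / (j%:~R - i%:~R).
have cE : c * (j%:~R - i%:~R) = j%:~R - X0 by rewrite divfK // gt_eqF.
have [below|above] := lerP Y0 (c * (m i)%:~R + (1 - c) * (m j)%:~R).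
  left; exists i, (m i), j, (m j), c; split=> //; try exact: mw.
    by rewrite ler_pdivlMr // ler_pdivrMr // mul0r mul1r; apply/andP; split; lra.
  by move: cE; lra.
have [d1 [d2 [u1 [u2 [g [d10 dE dP]]]]]] :=
  edge_split (@wedge_convex A C q r) ij (mw i iN) (mw j jN) edge.
right; exists (- d2), d1, (d1 * m i - d2 * i), u1, u2, g; split; last first.
  move=> X Y KXY h; apply: dP => //; apply: le_trans h _.
  by rewrite intrN; lra.
have d10R : 0 < d1%:~R :> R by rewrite ltr0z.
have dER : d1%:~R * t = d2%:~R :> R.
  apply: (mulIf (lt0r_neq0 ijR)); have := congr1 (fun z => z%:~R : R) dE.
  rewrite !intrM !intrB mj; lra.
rewrite intrB !intrM intrN -dER.
move: above; rewrite mj -(ltr_pM2l d10R); move: cE; nra.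
Qed.

End Plane.

(** * Finiteness of the cuts *)

Definition lin (S : pzRingType) n (c : 'cV[int]_n) (x : 'cV[S]_n) : S :=
  \sum_j (c j 0)%:~R * x j 0.

Lemma morphB_nmod (U V : zmodType) (phi : U -> V) :
  {morph phi : x y / x - y} ->
  [/\ phi 0 = 0, {morph phi : x y / x + y}
    & forall m, {morph phi : x / x *+ m}].
Proof.
move=> phiB; have phi0 : phi 0 = 0 by rewrite -[0 in LHS](subrr 0) phiB subrr.
have phiD : {morph phi : x y / x + y}.
  by move=> x y; rewrite -[y in LHS]opprK phiB -[- y]sub0r phiB phi0 sub0r opprK.
by split=> // m x; elim: m => [|m IH]; rewrite ?mulr0n // !mulrS phiD IH.
Qed.

Section Lin.
Variables (S : comPzRingType) (n : nat).
Implicit Types (c : 'cV[int]_n) (x : 'cV[S]_n).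

Lemma linDl c d x : lin (c + d) x = lin c x + lin d x.
Proof. by rewrite -big_split; apply: eq_bigr => j _; rewrite mxE intrD mulrDl. Qed.

Lemma linBl c d x : lin (c - d) x = lin c x - lin d x.
Proof. by rewrite -sumrB; apply: eq_bigr => j _; rewrite !mxE intrB mulrBl. Qed.

Lemma linZl k c x : lin (k *: c) x = k%:~R * lin c x.
Proof. by rewrite mulr_sumr; apply: eq_bigr => j _; rewrite mxE intrM mulrA. Qed.

Lemma linDr c x y : lin c (x + y) = lin c x + lin c y.
Proof. by rewrite -big_split; apply: eq_bigr => j _; rewrite mxE mulrDr. Qed.

Lemma linBr c x y : lin c (x - y) = lin c x - lin c y.
Proof. by rewrite -sumrB; apply: eq_bigr => j _; rewrite !mxE mulrBr. Qed.

Lemma linZr k c x : lin c (k *: x) = k * lin c x.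
Proof. by rewrite mulr_sumr; apply: eq_bigr => j _; rewrite mxE mulrCA. Qed.

Lemma lin0r c : lin c (0 : 'cV[S]_n) = 0.
Proof. by rewrite /lin big1 // => j _; rewrite mxE mulr0. Qed.

Lemma lin_sumr (I : Type) (r : seq I) (P : pred I) c (F : I -> 'cV[S]_n) :
  lin c (\sum_(i <- r | P i) F i) = \sum_(i <- r | P i) lin c (F i).
Proof.
by apply: (big_morph (lin c)); [exact: linDr|exact: lin0r].
Qed.

End Lin.

Section Cuts.
Variable n : nat.

(* [(c, d)] stands for the affine form [x |-> c x - d]; [ev] evaluates it at a point
   [(z, N)] of its homogenization, i.e. [ev (c, d) (z, N) = N (c (z / N) - d)]. *)
Local Notation aff := ('cV[int]_n * int)%type.
Implicit Types (p s g : aff).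

Definition ev s p : int := lin s.1 p.1 - s.2 * p.2.

Lemma evBr s p q : ev s (p - q) = ev s p - ev s q.
Proof. by rewrite /ev linBr /=; ring. Qed.

Lemma evBl p s g : ev (s - g) p = ev s p - ev g p.
Proof. by rewrite /ev linBl /=; ring. Qed.

Lemma morph_sum (phi : aff -> int) (l : seq aff) (k : 'I_(size l) -> nat) :
  {morph phi : p q / p - q} ->
  phi (\sum_(i < size l) l`_i *+ k i) = \sum_(i < size l) phi l`_i *+ k i.
Proof.
move=> /morphB_nmod [phi0 phiD phiMn].
by rewrite (big_morph phi phiD phi0); apply: eq_bigr => i _; apply: phiMn.
Qed.

Definition coords (j : option 'I_n) p : int := if j is Some j then p.1 j 0 else p.2.

Lemma coordsB j : {morph coords j : p q / p - q}.
Proof. by case: j => [j|] p q //=; rewrite !mxE. Qed.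

Lemma coords_inj p : (forall j, coords j p = 0) -> p = 0.
Proof.
case: p => z N p0; congr pair; last exact: (p0 None).
by apply/colP => j; rewrite mxE; apply: (p0 (Some j)).
Qed.

(** Strict positivity becomes finitely many weak integral inequalities: at least 1 at generators
    with positive last coordinate, at least 0 at rays. The list is independent of [f], so these are
    linear conditions on [f]. *)
Lemma strict_positivity_gens (I : finType) (B : I -> aff -> int) :
  (forall i, {morph B i : p q / p - q}) ->
  (forall p, (forall i, 0 <= B i p) -> 0 <= p.2) ->
  exists l : seq aff, (forall h, h \in l -> 0 <= h.2) /\
    forall f : aff -> int, {morph f : p q / p - q} ->
      (forall p, (forall i, 0 <= B i p) -> 0 < p.2 -> 0 < f p) <->
      (forall h, h \in l -> (0 < h.2)%R%:Z <= f h).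
Proof.
move=> BB B2; have [l [lB lP]] := gordan BB coordsB coords_inj.
have comb2 := morph_sum _ (coordsB None).
(* Without a generator of positive last coordinate there is no point to test, and the empty list
   imposes nothing. *)
exists (if has (fun h => 0 < h.2) l then l else [::]); split.
  by case: ifP => // _ h /lB /B2.
move=> f fB; split=> [f0 h|fl p Bp p2].
  case: ifP => // /hasP [h0 h0l h02] hl.
  case: (ltrP 0 h.2) => h2; first by have := f0 h (lB h hl) h2; lia.
  rewrite leNgt; apply/negP => fh.
  have fh0 := f0 h0 (lB _ h0l) h02.
  pose m := (`|f h0|)%N.
  have add (phi : aff -> int) : {morph phi : p q / p - q} ->
      phi (h0 + h *+ m) = phi h0 + phi h * m%:Z.
    by move=> /morphB_nmod [_ phiD phiMn]; rewrite phiD phiMn -mulr_natr natz.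
  have : 0 < f (h0 + h *+ m).
    apply: f0 => [i|].
      by rewrite add // addr_ge0 // ?lB // mulr_ge0 // lB.
    have /= -> := add (coords None) (coordsB None).
    by rewrite ltr_pwDl // mulr_ge0 // (B2 h (lB h hl)).
  by rewrite add //; nia.
have [k pk] := lP p Bp.
have p2k : p.2 = \sum_(i < size l) (l`_i).2 *+ k i by rewrite {1}pk; apply: comb2.
have [i li ki] : exists2 i : 'I_(size l), 0 < (l`_i).2 & (0 < k i)%N.
  apply/not_exists2P => no; move: p2; rewrite p2k ltNge => /negP; apply.
  apply: sumr_le0 => i _; case: (no i) => [/negP|/negP].
    by rewrite -leNgt => ti; rewrite mulrn_wle0.
  by rewrite -eqn0Ngt => /eqP ->.
have lmem (j : 'I_(size l)) : l`_j \in l by apply: mem_nth.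
move: fl; rewrite ifT; last by apply/hasP; exists l`_i.
move=> fl; rewrite pk morph_sum // (bigD1 i) //= ltr_pwDl //.
  by rewrite pmulrn_lgt0 //; have := fl _ (lmem i); rewrite li.
apply: sumr_ge0 => j _; rewrite mulrn_wge0 //.
by apply: le_trans (fl _ (lmem j)).
Qed.

Variables (I : finType) (A : I -> 'cV[int]_n) (b : I -> int).

Definition homog p : Prop := 0 <= p.2 /\ forall i, ev (A i, b i) p <= 0.

(* In terms of the rational points [x = z / N] of [A x <= b]: those with [s x >= 1]
   lie in the open strip [0 < g x < 1]. *)
Definition valid_cut s g : Prop := forall p, homog p -> 0 < p.2 ->
  ev g p <= 0 \/ p.2 <= ev g p -> ev s p < p.2.

Definition holds_at (R : numDomainType) (x : 'cV[R]_n) s : Prop :=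
  lin s.1 x <= s.2%:~R.

Definition sidecon g (o : option (option I)) p : int := match o with
  | None => g.2 * p.2 - lin g.1 p.1
  | Some None => p.2
  | Some (Some i) => b i * p.2 - lin (A i) p.1 end.

Lemma sidecon_ge0 g p :
  (forall o, 0 <= sidecon g o p) <-> homog p /\ ev g p <= 0.
Proof.
rewrite /homog /ev; split=> [H|[[p2 pA] pg] [[i|]|] //=].
- split; last by have := H None; rewrite /=; lia.
  split=> [|i]; first exact: (H (Some None)).
  by have := H (Some (Some i)); rewrite /=; lia.
- by have := pA i; rewrite /=; lia.
- by lia.
Qed.

Lemma sideconB g o : {morph sidecon g o : p q / p - q}.
Proof. by case: o => [[i|]|] p q //=; rewrite linBr; ring. Qed.

(** With [strict_positivity_gens] on both sides of the strip, validity of [s] is a finite system of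
    inequalities linear in the integral vector [s], and [gordan_inhomogeneous] generates its
    solutions. The recession generators are valid cuts as well, so each [s] is a sum of listed
    cuts. *)
Lemma fixed_split_finite g :
  exists l : seq aff, (forall s, s \in l -> valid_cut s g) /\
    forall s, valid_cut s g ->
    forall (R : numDomainType) (x : 'cV[R]_n),
      (forall s', s' \in l -> holds_at x s') -> holds_at x s.
Proof.
have side2 g' p : (forall o, 0 <= sidecon g' o p) -> 0 <= p.2.
  by move=> /(_ (Some None)).
have [l0 [l02 l0P]] := strict_positivity_gens (sideconB g) (side2 g).
(* As an affine form [g'] is [1 - g], so [g' <= 0] describes the far side of the strip. *)
pose g' : aff := (- g.1, - g.2 - 1).
have [l1 [l12 l1P]] := strict_positivity_gens (sideconB g') (side2 g').
pose L := l0 ++ l1.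
have L2 h : h \in L -> 0 <= h.2 by rewrite mem_cat => /orP [/l02|/l12].
pose gap s p : int := p.2 - ev s p.
have gapB s : {morph gap s : p q / p - q}.
  by move=> p q; rewrite /gap evBr /=; ring.
have g'E p : ev g' p = p.2 - ev g p.
  rewrite /ev /g' /= -[- g.1]scaleN1r linZl; ring.
have LP s : valid_cut s g <-> forall h, h \in L -> (0 < h.2)%R%:Z <= gap s h.
  split=> [sg h|sL p hp p2 [pg|pg]].
  - rewrite mem_cat => /orP [] hl.
      apply: (proj1 (l0P _ (gapB s))) hl => p /sidecon_ge0 [hp pg] p2.
      by rewrite /gap subr_gt0; apply: sg => //; left.
    apply: (proj1 (l1P _ (gapB s))) hl => p /sidecon_ge0 [hp pg] p2.
    rewrite /gap subr_gt0; apply: sg => //; right.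
    by move: pg; rewrite g'E subr_le0.
  - rewrite -subr_gt0; apply: (proj2 (l0P _ (gapB s))) p2.
      by move=> h hl; apply: sL; rewrite mem_cat hl.
    by apply/sidecon_ge0.
  - rewrite -subr_gt0; apply: (proj2 (l1P _ (gapB s))) p2.
      by move=> h hl; apply: sL; rewrite mem_cat hl orbT.
    by apply/sidecon_ge0; rewrite g'E subr_le0.
have evNB (i : 'I_(size L)) : {morph (fun s => - ev s L`_i) : s s' / s - s'}.
  by move=> s s' /=; rewrite evBl; ring.
have [m0 [m [m0P mP decomp]]] := gordan_inhomogeneous
  (fun i : 'I_(size L) => (0 < (L`_i).2)%R%:Z - (L`_i).2) evNB coordsB coords_inj.
have Lmem (i : 'I_(size L)) : L`_i \in L by apply: mem_nth.
exists (m0 ++ m); split=> [s|s /LP sL R x xm].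
  rewrite mem_cat => /orP [/m0P|/mP] sm; apply/LP => h /(nthP 0) [i iL <-].
    by have := sm (Ordinal iL); rewrite /gap /= lerBlDr addrC.
  apply: le_trans (_ : (L`_i).2 <= _).
    by have := L2 _ (Lmem (Ordinal iL)); case: ltrP => //=; lia.
  by have := sm (Ordinal iL); rewrite /gap lerDl.
have [|s0 s0m [k sE]] := decomp s.
  by move=> i; rewrite lerBlDr addrC; apply: sL.
pose val s := lin s.1 x - s.2%:~R.
have valP s' : holds_at x s' <-> val s' <= 0 by rewrite /holds_at /val subr_le0.
have [val0 valD valM] : [/\ val 0 = 0, {morph val : s1 s2 / s1 + s2}
    & forall j, {morph val : s1 / s1 *+ j}].
  by apply: morphB_nmod => s1 s2; rewrite /val linBl /= intrB; ring.
have mmem (i : 'I_(size m)) : m`_i \in m by apply: mem_nth.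
apply/valP; rewrite sE valD (big_morph val valD val0).
rewrite -[X in _ <= X](addr0 0) lerD //; first by apply/valP/xm; rewrite mem_cat s0m.
apply: sumr_le0 => i _; rewrite valM mulrn_wle0 //.
by apply/valP/xm; rewrite mem_cat mmem orbT.
Qed.

(** Dickson's lemma selects finitely many strips [G] such that each strip is compared by [split_le],
    at the generators of the cone over the polyhedron, with one in [G]; [split_dominated] transfers
    its cuts to that one. *)
Lemma cuts_finite :
  exists l : seq aff, (forall s, s \in l -> exists g, valid_cut s g) /\
    forall s g, valid_cut s g ->
    forall (R : numDomainType) (x : 'cV[R]_n),
      (forall s', s' \in l -> holds_at x s') -> holds_at x s.
Proof.
pose B (o : option I) p := sidecon 0 (Some o) p.
have BB o : {morph B o : p q / p - q} by apply: sideconB.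
have [H [HB HP]] := gordan BB coordsB coords_inj.
have BP p : (forall o, 0 <= B o p) <-> homog p.
  rewrite /homog /ev; split=> [Bp|[p2 pA] [i|] //=].
    split=> [|i]; first exact: (Bp None).
    by have := Bp (Some i); rewrite /B /=; lia.
  by have := pA i; rewrite /B /=; lia.
pose t (i : 'I_(size H)) := (H`_i).2.
have t0 i : 0 <= t i by have /BP [] := HB H`_i (mem_nth 0 (ltn_ord i)).
(* Both the clipped value and its complement to [t] are recorded, so that domination forces the
   clipped values to be equal. *)
pose phi (o : 'I_(size H) * 'I_4) g : nat :=
  let v := ev g H`_(o.1) in
  absz (nth 0 [:: clip (t o.1) v; t o.1 - clip (t o.1) v;
               Num.max (- v) 0; Num.max (v - t o.1) 0] o.2).
have [G [_ GP]] := dickson phi (enum {: 'I_(size H) * 'I_4}) (fun=> True).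
have GP' g : exists2 g0, g0 \in G & forall i,
    split_le (t i) (ev g0 H`_i) (ev g H`_i).
  have [g0 g0G g0g] := GP g Logic.I; exists g0 => // i.
  have {}g0g j (j4 : (j < 4)%N) := g0g (i, Ordinal j4) (mem_enum _ _).
  have clip_itv v : 0 <= clip (t i) v <= t i.
    by move: (t0 i); rewrite /clip; lia.
  split; last 2 first.
  - by move: (g0g 2%N isT); rewrite /phi /=; lia.
  - by move: (g0g 3%N isT); rewrite /phi /=; lia.
  move: (g0g 0%N isT) (g0g 1%N isT); rewrite /phi /=.
  move: (clip _ _) (clip _ _) (clip_itv (ev g0 H`_i)) (clip_itv (ev g H`_i)).
  by move=> c c'; lia.
have dom s g g0 : (forall i, split_le (t i) (ev g0 H`_i) (ev g H`_i)) ->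
    valid_cut s g -> valid_cut s g0.
  move=> g0g sg.
  pose P k := \sum_(i < size H) H`_i *+ k i.
  have Phomog k : homog (P k).
    apply/BP => o; rewrite morph_sum //; apply: sumr_ge0 => i _.
    by rewrite mulrn_wge0 // HB // mem_nth.
  have P2 k : (P k).2 = weigh k t.
    exact: (morph_sum k (coordsB None)).
  have Pev k s' : ev s' (P k) = weigh k (fun i => ev s' H`_i).
    by rewrite morph_sum //; apply: evBr.
  have Pf k : (P k).2 - ev s (P k) = weigh k (fun i => t i - ev s H`_i).
    by rewrite P2 Pev -weighB.
  move=> p /BP /HP [k ->]; rewrite -/(P k) P2 => kt kg.
  rewrite -subr_gt0 -P2 Pf; apply: (split_dominated t0 g0g) kt _ => //.
    move=> k' k't k'g; rewrite -Pf subr_gt0; apply: sg => //; rewrite P2 //.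
    by rewrite Pev.
  by rewrite /outside -Pev.
have [L LP] := choice fixed_split_finite.
exists (flatten [seq L g | g <- G]); split=> [s /flatten_mapP [g _ sL]|s g sg R x xL].
  by exists g; apply: (LP g).1.
have [g0 g0G g0g] := GP' g.
apply: ((LP g0).2 s (dom _ _ _ g0g sg) R x) => s' s'L.
by apply: xL; apply/flatten_mapP; exists g0.
Qed.

End Cuts.

(** * Integer hulls of two half-spaces *)

Lemma common_denominator (I : finType) (q : I -> rat) :
  exists2 D : int, 0 < D & exists z : I -> int, forall i, q i * D%:~R = (z i)%:~R.
Proof.
exists (\prod_i denq (q i)); first by apply: prodr_gt0 => i _; apply: denq_gt0.
exists (fun i => numq (q i) * \prod_(j | j != i) denq (q j)) => i.
rewrite (bigD1 i) //= !intrM mulrA; congr (_ * _).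
by rewrite -[X in X * _]divq_num_den divfK // intr_eq0 denq_neq0.
Qed.

Lemma lin_intr (S : comPzRingType) n (c z : 'cV[int]_n) :
  lin c (map_mx intr z : 'cV[S]_n) = (lin c z)%:~R.
Proof.
rewrite /lin -[RHS]/(intr _) rmorph_sum; apply: eq_bigr => j _.
by rewrite mxE /= intz intrM.
Qed.

Lemma lin_delta n (w : 'cV[int]_n) i :
  lin w (delta_mx i 0 : 'cV[int]_n) = w i 0.
Proof.
rewrite /lin (bigD1 i) //= big1 => [|j /negPf ji]; rewrite mxE ?eqxx ?ji /=.
  by rewrite intz mulr1 addr0.
by rewrite mulr0.
Qed.

(** For an integral multiple [z] of [a], the least positive value of [lin z] divides every
    coordinate of [z], since a remainder would be a smaller positive value; dividing by it makes the
    minimizer [e] dual to [w]. *)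
Lemma primitive_vector n (a : 'cV[rat]_n) : a != 0 ->
  exists (p : rat) (w e : 'cV[int]_n),
    [/\ 0 < p, a = p *: map_mx intr w & lin w e = 1].
Proof.
move=> a0; have [D D0 [z0 zP]] := common_denominator (fun i => a i 0).
pose z : 'cV[int]_n := \col_i z0 i.
have aD : D%:~R *: a = map_mx intr z.
  by apply/colP => i; rewrite !mxE mulrC zP.
have zn0 : z != 0.
  apply: contra a0 => /eqP z0'; apply/eqP.
  have : D%:~R *: a = 0 by rewrite aD z0'; apply/colP => i; rewrite !mxE.
  by move/eqP; rewrite scaler_eq0 intr_eq0 gt_eqF //= => /eqP.
have linz : 0 < lin z z.
  have [i zi] : exists i, z i 0 != 0.
    apply/existsP; rewrite -negb_forall; apply: contra zn0 => /forallP z0'.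
    by apply/eqP/colP => i; rewrite [RHS]mxE; apply/eqP.
  rewrite /lin (bigD1 i) //= intz ltr_pwDl //.
    by rewrite lt_neqAle eq_sym mulf_neq0 //= -expr2 sqr_ge0.
  by apply: sumr_ge0 => j _; rewrite intz -expr2 sqr_ge0.
pose Q d := `[< exists e, 0 < lin z e /\ `|lin z e|%N = d >].
have exQ : exists d, Q d by exists `|lin z z|%N; apply/asboolP; exists z.
case: (ex_minnP exQ) => d /asboolP [e [e0 ed]] dmin.
pose f := lin z e.
have fz i : dvdz f (z i 0).
  apply/dvdz_mod0P/eqP; apply: contraT => r0.
  have f0 : f != 0 by rewrite gt_eqF.
  pose e' : 'cV[int]_n := delta_mx i 0 - divz (z i 0) f *: e.
  have e'E : lin z e' = modz (z i 0) f.
    rewrite /e' linBr linZr.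
    rewrite lin_delta.
    by rewrite {1}(divz_eq (z i 0) f) -/f; ring.
  have r1 : 0 <= modz (z i 0) f by apply: modz_ge0.
  have r2 : modz (z i 0) f < f by rewrite ltz_pmod.
  have : (d <= `|lin z e'|)%N.
    apply: dmin; apply/asboolP; exists e'; split=> //; rewrite e'E.
    by rewrite lt_neqAle eq_sym r0.
  by rewrite e'E -ed -/f; lia.
pose w : 'cV[int]_n := \col_i divz (z i 0) f.
have zw : z = f *: w.
  by apply/colP => i; rewrite [RHS]mxE mulrC [w i 0]mxE divzK //; apply: fz.
exists (f%:~R / D%:~R), w, e; split.
- by rewrite divr_gt0 // ltr0z.
- have D0' : D%:~R != 0 :> rat by rewrite intr_eq0 gt_eqF.
  apply: (scalerI D0'); rewrite aD scalerA mulrCA divff // mulr1 zw.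
  by apply/colP => i; rewrite !mxE intrM.
- have f0 : f != 0 by rewrite gt_eqF.
  by apply: (mulfI f0); rewrite mulr1 {2}/f zw linZl intz.
Qed.

Section Hull.
Variables (R : realType) (n : nat).
Local Open Scope classical_set_scope.
Implicit Types (Q K P : set 'cV[R]_n) (x y : 'cV[R]_n) (z : 'cV[int]_n).
Local Notation aff := ('cV[int]_n * int)%type.
Local Notation real z := (map_mx intr z : 'cV[R]_n).

Lemma conv_mem Q x : Q x -> conv Q x.
Proof.
move=> Qx; exists 1%N, (fun=> 1), (fun=> x); split=> //.
- by rewrite big_ord1.
- by rewrite big_ord1 scale1r.
Qed.

Lemma conv_convex Q x y (c : R) : 0 <= c <= 1 -> conv Q x -> conv Q y ->
  conv Q (c *: x + (1 - c) *: y).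
Proof.
move=> /andP [c0 c1] [k [l [p [l0 l1 Qp ->]]]] [k' [l' [p' [l'0 l'1 Qp' ->]]]].
exists (k + k')%N,
  (fun i => match split i with inl j => c * l j | inr j => (1 - c) * l' j end),
  (fun i => match split i with inl j => p j | inr j => p' j end); split.
- by move=> i; case: split => j; rewrite mulr_ge0 // subr_ge0.
- rewrite big_split_ord /=.
  under eq_bigr do rewrite (unsplitK (inl _ _)).
  under [X in _ + X]eq_bigr do rewrite (unsplitK (inr _ _)).
  by rewrite -!mulr_sumr l1 l'1; ring.
- by move=> i; case: split.
- rewrite big_split_ord /= !scaler_sumr; congr (_ + _); apply: eq_bigr => i _.
    by rewrite (unsplitK (inl _ _)) scalerA.
  by rewrite (unsplitK (inr _ _)) scalerA.
Qed.

Lemma integer_pointsP x : integer_points x <-> exists z, x = real z.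
Proof.
split=> [xi|[z ->]]; last by apply/mxOverP => i j; rewrite mxE intr_int.
exists (map_mx Num.floor x); apply/colP => i; rewrite !mxE floorK //.
exact: (mxOverP xi).
Qed.

Lemma hull_mem K z : K (real z) -> integer_hull K (real z).
Proof. by move=> Kz; apply: conv_mem; split=> //; apply/integer_pointsP; exists z. Qed.

(** Shifts by integral multiples of [z] keep lattice points in [K]; a real multiple lies between [y]
    and its shift by an integer [N >= t]. *)
Lemma hull_ray K z y (t : R) : (forall x, K x -> K (x + real z)) ->
  integer_hull K y -> 0 <= t -> integer_hull K (y + t *: real z).
Proof.
move=> Kz Ky t0; pose N := (`|Num.floor t|.+1)%N.
have tN : t <= N%:R.
  apply: ltW; apply: lt_le_trans (floorD1_gt t) _.
  by rewrite -[N%:R]/(N%:Z%:~R) ler_int /N; move: (Num.floor t) => f; lia.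
have N0 : 0 < N%:R :> R by rewrite ltr0n.
have KN x m : K x -> K (x + m%:R *: real z).
  move=> Kx; elim: m => [|m IH]; first by rewrite scale0r addr0.
  by rewrite -natr1 scalerDl scale1r addrA; apply: Kz.
have : integer_hull K (y + N%:R *: real z).
  case: Ky => k [l [p [l0 l1 Kp ->]]]; exists k, l, (fun i => p i + N%:R *: real z).
  split=> //.
    move=> i; have [Kpi /integer_pointsP [v pv]] := Kp i; split; first exact: KN.
    apply/integer_pointsP; exists (v + N%:Z *: z); rewrite pv.
    by apply/colP => j; rewrite !mxE intrD intrM.
  under [RHS]eq_bigr do rewrite scalerDr.
  by rewrite big_split /= -scaler_suml l1 scale1r.
have c01 : 0 <= t / N%:R <= 1.
  by rewrite divr_ge0 ?(ltW N0) //= ler_pdivrMr // mul1r.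
move=> hN; have := conv_convex c01 hN Ky.
rewrite scalerDr addrAC -scalerDl [_ + (1 - _)]addrC subrK scale1r scalerA.
by rewrite divfK // gt_eqF.
Qed.

Lemma hull_line K z y (t : R) : (forall x, K x -> K (x + real z)) ->
  (forall x, K x -> K (x - real z)) ->
  integer_hull K y -> integer_hull K (y + t *: real z).
Proof.
move=> Kz Kz' Ky; have [t0|t0] := lerP 0 t; first exact: hull_ray.
have -> : t *: real z = (- t) *: real (- z).
  by rewrite scaleNr map_mxN scalerN opprK.
by apply: hull_ray => // [x Kx|]; rewrite ?map_mxN; [apply: Kz'|lra].
Qed.

Lemma hull_lines K (v : 'I_n -> 'cV[int]_n) (t : 'I_n -> R) y :
  (forall i x, K x -> K (x + real (v i))) ->
  (forall i x, K x -> K (x - real (v i))) ->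
  integer_hull K y -> integer_hull K (y + \sum_i t i *: real (v i)).
Proof.
move=> Kv Kv' Ky; elim/big_rec: _ => [|i u _ IH]; first by rewrite addr0.
by rewrite addrCA addrC; apply: hull_line IH; [apply: Kv|apply: Kv'].
Qed.

Lemma hull_setT x : integer_hull setT x.
Proof.
have -> : x = real 0 + \sum_i x i 0 *: real (delta_mx i 0).
  apply/colP => j; rewrite !mxE add0r summxE (bigD1 j) //= !mxE !eqxx mulr1.
  by rewrite big1 ?addr0 // => i /negPf ij; rewrite !mxE eq_sym ij mulr0.
by apply: hull_lines => //; apply: hull_mem.
Qed.

Lemma hull_le K (s : aff) x :
  (forall z, K (real z) -> lin s.1 z <= s.2) -> integer_hull K x -> holds_at x s.
Proof.
move=> Ks [k [l [p [l0 l1 Kp ->]]]]; rewrite /holds_at lin_sumr.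
rewrite -[X in _ <= X]mul1r -[X in X * _]l1 mulr_suml.
apply: ler_sum => i _; rewrite linZr.
rewrite ler_wpM2l //; have [Kpi /integer_pointsP [z pz]] := Kp i.
by rewrite pz lin_intr ler_int Ks // -pz.
Qed.

Lemma ratr_form (a : 'cV[rat]_n) (p : rat) (w : 'cV[int]_n) x :
  a = p *: map_mx intr w ->
  \sum_(i < n) ratr (a i 0) * x i 0 = ratr p * lin w x.
Proof.
move=> ->; rewrite /lin mulr_sumr; apply: eq_bigr => i _.
by rewrite !mxE rmorphM /= ratr_int mulrA.
Qed.

Definition set_cut K (s g : aff) : Prop := forall x, K x ->
  (s.2 + 1)%:~R <= lin s.1 x -> g.2%:~R < lin g.1 x < (g.2 + 1)%:~R.

(** The case of parallel normals, where only [lin w x] matters. Rounding the bounds gives cuts with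
    nothing beyond them, and these put the lattice hyperplanes next to [x] into [K]. *)
Lemma slab_hull (A B k : R) (w e : 'cV[int]_n) x
    (K := [set x | lin w x <= A /\ k * lin w x <= B]) :
  lin w e = 1 -> k != 0 ->
  (forall s g, set_cut K s g -> holds_at x s) -> integer_hull K x.
Proof.
move=> we k0 cuts; pose X := lin w x.
(* No point of [K] lies beyond such a cut, so any strip serves. *)
have empty_cut (s : aff) : (forall x, K x -> lin s.1 x < (s.2 + 1)%:~R) -> holds_at x s.
  by move=> sK; apply: (cuts s 0) => y /sK ys; rewrite leNgt ys.
pose f := Num.floor X.
have fX : f%:~R <= X := floor_le X; have Xf : X < (f + 1)%:~R := floorD1_gt X.
have XA : X <= (Num.floor A)%:~R.
  apply: (empty_cut (w, Num.floor A)) => y [yA _].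
  exact: le_lt_trans yA (floorD1_gt A).
have KE y : K y = (lin w y <= A /\ k * lin w y <= B) by [].
have linE (j : int) : lin w (real (j *: e)) = j%:~R.
  by rewrite lin_intr linZr we mulr1.
have [fB f1B] : k * f%:~R <= B /\ (X != f%:~R -> k * (f + 1)%:~R <= B).
  have [k'|k'|/eqP] := ltrgtP k 0; last by rewrite (negPf k0).
    pose M := Num.floor (- (B / k)).
    have XM : - X <= M%:~R.
      have := empty_cut (- w, M); rewrite /holds_at /= -!scaleN1r !linZl mulN1r.
      apply=> y [_]; rewrite linZl mulrC -ler_ndivrMr // mulN1r => yB.
      by apply: le_lt_trans (floorD1_gt _); lra.
    have fM : - M <= f by rewrite floor_ge_int intrN; lra.
    have MB : B / k <= (- M)%:~R.
      by rewrite intrN; have := floor_le (- (B / k)); rewrite -/M; lra.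
    have aux (j : int) : - M <= j -> k * j%:~R <= B.
      move=> Mj; rewrite mulrC -ler_ndivrMr //.
      by apply: le_trans MB _; rewrite ler_int.
    by split=> [|_]; apply: aux => //; lia.
  have XB : X <= (Num.floor (B / k))%:~R.
    apply: (empty_cut (w, Num.floor (B / k))) => y [_].
    rewrite mulrC -ler_pdivlMr // => yB.
    exact: le_lt_trans yB (floorD1_gt _).
  have aux (j : int) : j <= Num.floor (B / k) -> k * j%:~R <= B.
    by rewrite floor_ge_int ler_pdivlMr // mulrC.
  split; first by apply: aux; rewrite -(ler_int R); lra.
  move=> Xnf; apply: aux; rewrite -ltzD1 ltrD2r -(ltr_int R).
  by apply: lt_le_trans XB; rewrite lt_neqAle eq_sym Xnf fX.
have fA : f%:~R <= A by apply: le_trans fX (le_trans XA (floor_le A)).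
have f1A : X != f%:~R -> (f + 1)%:~R <= A.
  move=> Xnf; apply: le_trans (floor_le A); rewrite ler_int -ltzD1 ltrD2r -(ltr_int R).
  by apply: lt_le_trans XA; rewrite lt_neqAle eq_sym Xnf fX.
have hullXe : integer_hull K (X *: real e).
  have Kf : integer_hull K (real (f *: e)) by apply: hull_mem; rewrite KE linE.
  have [Xf'|Xnf] := eqVneq X f%:~R; first by rewrite Xf' -map_mxZ.
  have Kf1 : integer_hull K (real ((f + 1) *: e)).
    by apply: hull_mem; rewrite KE linE; split; [exact: f1A|exact: f1B].
  have -> : X *: real e =
      (X - f%:~R) *: real ((f + 1) *: e) + (1 - (X - f%:~R)) *: real (f *: e).
    by rewrite !map_mxZ !scalerA -scalerDl /= intrD; congr (_ *: _); ring.
  by apply: conv_convex => //; move: Xf; rewrite intrD => Xf; apply/andP; split; lra.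
pose v i : 'cV[int]_n := delta_mx i 0 - w i 0 *: e.
have lv i : lin w (real (v i)) = 0.
  by rewrite lin_intr /v linBr linZr lin_delta we mulr1 subrr.
have -> : x = X *: real e + \sum_i x i 0 *: real (v i).
  apply/colP => j; rewrite !mxE summxE.
  under eq_bigr do rewrite !mxE intrB intrM mulrBr mulrA.
  rewrite sumrB -mulr_suml (bigD1 j) //= !eqxx mulr1 big1 => [|i /negPf ij].
    rewrite addr0 /X /lin; under eq_bigr do rewrite mulrC.
    by rewrite addrC subrK.
  by rewrite eq_sym ij mulr0.
apply: hull_lines => // i y; rewrite !KE; first by rewrite linDr lv addr0.
by rewrite linBr lv subr0.
Qed.

(** The forms [w1], [w2] project [K] to a planar wedge along integral directions; the dual vectors
    [e1], [e2] lift the planar alternative back. *)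
Lemma wedge_hull (A C : R) (q r : int) (w1 w2 e1 e2 : 'cV[int]_n) x
    (K := [set x | wedge A C q r (lin w1 x) (lin w2 x)]) :
  0 < r -> coprimez q r -> lin w1 e1 = 1 -> lin w1 e2 = 0 -> lin w2 e1 = 0 ->
  lin w2 e2 = 1 ->
  (forall s g, set_cut K s g -> holds_at x s) -> integer_hull K x.
Proof.
move=> r0 qr w11 w12 w21 w22 cuts.
pose X := lin w1 x; pose Y := lin w2 x.
have KE y : K y = wedge A C q r (lin w1 y) (lin w2 y) by [].
have XA : X <= (Num.floor A)%:~R.
  apply: (cuts (w1, Num.floor A) 0) => y [yA _] /=.
  by rewrite leNgt (le_lt_trans yA (floorD1_gt A)).
have [[i [a [j [b [c [Kp Kq c01 XE YE]]]]]]|] :=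
  wedge_hull_or_cut C Y r0 qr XA; last first.
  move=> [c1 [c2 [d [u1 [u2 [g [xd cut]]]]]]].
  have := cuts (c1 *: w1 + c2 *: w2, d) (u1 *: w1 + u2 *: w2, g).
  rewrite /holds_at /= linDl !linZl leNgt xd => H; exfalso; suff: false by [].
  by apply: H => y Ky /=; rewrite !linDl !linZl; apply: cut.
have lin1 (k l : int) : lin w1 (real (k *: e1 + l *: e2)) = k%:~R.
  by rewrite lin_intr linDr !linZr w11 w12 mulr1 mulr0 addr0.
have lin2 (k l : int) : lin w2 (real (k *: e1 + l *: e2)) = l%:~R.
  by rewrite lin_intr linDr !linZr w21 w22 mulr1 mulr0 add0r.
pose p := real (i *: e1 + a *: e2); pose p' := real (j *: e1 + b *: e2).
have hp : integer_hull K p by apply: hull_mem; rewrite KE lin1 lin2.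
have hp' : integer_hull K p' by apply: hull_mem; rewrite KE lin1 lin2.
have hpp' := conv_convex c01 hp hp'.
pose h := c * a%:~R + (1 - c) * b%:~R - Y.
have h0 : 0 <= h by rewrite subr_ge0.
have XYh : integer_hull K (X *: real e1 + Y *: real e2).
  have -> : X *: real e1 + Y *: real e2 = c *: p + (1 - c) *: p' + h *: real (- e2).
    apply/colP => k; rewrite /p /p' /h XE !mxE !(intrD, intrM, intrN); ring.
  apply: hull_ray => // y; rewrite !KE linDr linDr !lin_intr -scaleN1r !linZr w12 w22.
  rewrite mulr0 addr0 mulr1 => -[yA yC]; split=> //.
  have r0R : 0 < r%:~R :> R by rewrite ltr0z.
  by rewrite intrN; lra.
pose v i : 'cV[int]_n := delta_mx i 0 - (w1 i 0 *: e1 + w2 i 0 *: e2).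
have lv1 k : lin w1 (real (v k)) = 0.
  by rewrite lin_intr /v linBr linDr !linZr lin_delta w11 w12 mulr1 mulr0 addr0 subrr.
have lv2 k : lin w2 (real (v k)) = 0.
  by rewrite lin_intr /v linBr linDr !linZr lin_delta w21 w22 mulr1 mulr0 add0r subrr.
have -> : x = X *: real e1 + Y *: real e2 + \sum_k x k 0 *: real (v k).
  apply/colP => k; rewrite !mxE summxE.
  under eq_bigr do rewrite !mxE intrB intrD !intrM mulrBr mulrDr !mulrA.
  rewrite sumrB big_split /= -!mulr_suml (bigD1 k) //= !eqxx mulr1.
  rewrite big1 => [|l /negPf lk].
    have linC (w : 'cV[int]_n) : \sum_i x i 0 * (w i 0)%:~R = lin w x.
      by apply: eq_bigr => i0 _; rewrite mulrC.
    by rewrite !linC -/X -/Y; ring.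
  by rewrite eq_sym lk mulr0.
apply: hull_lines => // k y; rewrite !KE; first by rewrite !linDr lv1 lv2 !addr0.
by rewrite !linBr lv1 lv2 !subr0.
Qed.

(** Lattice coordinates adapted to the two normals reduce everything to the slab, if they are
    parallel, or to the wedge. *)
Lemma hull_of_cuts (H1 H2 : set 'cV[R]_n) x :
  rational_halfspace H1 -> rational_halfspace H2 ->
  (forall s g, set_cut (H1 `&` H2) s g -> holds_at x s) ->
  integer_hull (H1 `&` H2) x.
Proof.
move=> [a [alpha [a0 ->]]] [b [beta [b0 ->]]].
have [p1 [w1 [e1 [p10 aE w11]]]] := primitive_vector a0.
have p10R : 0 < ratr p1 :> R by rewrite ltr0q.
(* Removing this multiple of [w1] makes the rest of [b] vanish on [e1], as a dual system
   requires. *)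
pose k : rat := \sum_i b i 0 * (e1 i 0)%:~R.
pose b' := b - k *: map_mx intr w1.
have bE : b = k *: map_mx intr w1 + b' by rewrite addrC subrK.
have formb y : \sum_(i < n) ratr (b i 0) * y i 0 =
    ratr k * lin w1 y + \sum_(i < n) ratr (b' i 0) * y i 0 :> R.
  rewrite {1}bE /lin mulr_sumr -big_split; apply: eq_bigr => i _ /=.
  by rewrite !mxE rmorphD rmorphM /= ratr_int mulrDl mulrA.
have Aeq y : (\sum_(i < n) ratr (a i 0) * y i 0 <= ratr alpha) =
    (lin w1 y <= ratr alpha / ratr p1) :> bool.
  by rewrite (ratr_form y aE) [RHS]ler_pdivlMr // mulrC.
have [b'0|b'n0] := eqVneq b' 0.
  have kn0 : k != 0.
    by apply: contra b0 => /eqP k0; rewrite bE b'0 k0 scale0r addr0.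
  have KE : [set x : 'cV[R]_n | \sum_(i < n) ratr (a i 0) * x i 0 <= ratr alpha] `&`
      [set x : 'cV[R]_n | \sum_(i < n) ratr (b i 0) * x i 0 <= ratr beta] =
      [set x | lin w1 x <= ratr alpha / ratr p1 /\ ratr k * lin w1 x <= ratr beta].
    have Beq y : \sum_(i < n) ratr (b i 0) * y i 0 = ratr k * lin w1 y :> R.
      rewrite formb b'0 [X in _ + X]big1 ?addr0 // => i _.
      by rewrite mxE rmorph0 mul0r.
    by apply/seteqP; split=> y; rewrite /setI /= Aeq Beq.
  by rewrite KE => cuts; apply: (slab_hull w11 _ cuts); rewrite fmorph_eq0.
have [p2 [w2 [e2 [p20 b'E w22]]]] := primitive_vector b'n0.
have p20R : 0 < ratr p2 :> R by rewrite ltr0q.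
have w21 : lin w2 e1 = 0.
  have p2n0 : p2 != 0 by rewrite gt_eqF.
  have : \sum_i b' i 0 * (e1 i 0)%:~R = 0.
    under eq_bigr do rewrite !mxE mulrBl -mulrA -intrM.
    rewrite sumrB -/k -mulr_sumr.
    have -> : \sum_i (w1 i 0 * e1 i 0)%:~R = (lin w1 e1)%:~R :> rat.
      rewrite /lin -[RHS]/(intr _) rmorph_sum; apply: eq_bigr => i _.
      by rewrite /= intz.
    by rewrite w11 mulr1 subrr.
  have -> : \sum_i b' i 0 * (e1 i 0)%:~R = p2 * (lin w2 e1)%:~R.
    rewrite /lin -[X in p2 * X]/(intr _) rmorph_sum mulr_sumr b'E.
    by apply: eq_bigr => i _; rewrite !mxE /= intz intrM mulrA.
  by move/eqP; rewrite mulf_eq0 (negPf p2n0) intr_eq0 => /eqP.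
pose e2' := e2 - (lin w1 e2) *: e1.
have w12' : lin w1 e2' = 0 by rewrite /e2' linBr linZr w11 mulr1 subrr.
have w22' : lin w2 e2' = 1 by rewrite /e2' linBr linZr w21 mulr0 subr0.
(* In lowest terms this quotient provides the coprime coefficients [q] and [r] of the wedge. *)
pose sg := k / p2.
have r0 : 0 < denq sg := denq_gt0 sg.
have r0R : 0 < (denq sg)%:~R :> R by rewrite ltr0z.
have KE : [set x : 'cV[R]_n | \sum_(i < n) ratr (a i 0) * x i 0 <= ratr alpha] `&`
    [set x : 'cV[R]_n | \sum_(i < n) ratr (b i 0) * x i 0 <= ratr beta] =
    [set x | wedge (ratr alpha / ratr p1) ((denq sg)%:~R * (ratr beta / ratr p2))
       (numq sg) (denq sg) (lin w1 x) (lin w2 x)].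
  have sgR : ratr k = (numq sg)%:~R / (denq sg)%:~R * ratr p2 :> R.
    have -> : k = (numq sg)%:~R / (denq sg)%:~R * p2.
      by rewrite divq_num_den /sg divfK // gt_eqF.
    by rewrite rmorphM fmorph_div /= !ratr_int.
  have Beq y : (\sum_(i < n) ratr (b i 0) * y i 0 <= ratr beta :> R) =
      ((denq sg)%:~R * lin w2 y + (numq sg)%:~R * lin w1 y <=
        (denq sg)%:~R * (ratr beta / ratr p2)).
    have c0 : 0 < (denq sg)%:~R / ratr p2 :> R by rewrite divr_gt0.
    rewrite formb (ratr_form y b'E) sgR -[LHS](ler_pM2l c0).
    have dn0 : (denq sg)%:~R != 0 :> R by rewrite gt_eqF.
    have pn0 : ratr p2 != 0 :> R by rewrite gt_eqF.
    by congr (_ <= _); field; rewrite ?dn0 ?pn0.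
  by apply/seteqP; split=> y; rewrite /setI /wedge /= Aeq Beq.
rewrite KE => cuts.
by apply: (wedge_hull r0 _ w11 w12' w21 w22' cuts); rewrite coprimezE coprime_num_den.
Qed.

End Hull.

(** * The closure *)

Local Open Scope classical_set_scope.

Lemma integral_description (R : realType) n (P : set 'cV[R]_n) :
  rational_polyhedron P ->
  exists (I : finType) (A : I -> 'cV[int]_n) (b : I -> int),
    P = [set x | forall i, holds_at x (A i, b i)].
Proof.
move=> [m [A [b ->]]].
have [D D0 [z zP]] := common_denominator (fun o : 'I_m * option 'I_n =>
  if o.2 is Some j then A o.1 j else b o.1 0).
exists 'I_m, (fun i => \col_j z (i, Some j)), (fun i => z (i, None)).
have DR : 0 < D%:~R :> R by rewrite ltr0z.
have zR o : (z o)%:~R = ratr ((z o)%:~R) :> R by rewrite ratr_int.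
have row x i : holds_at x (\col_j z (i, Some j), z (i, None)) <->
    (map_mx ratr A *m x) i 0 <= ratr (b i 0) :> R.
  rewrite /holds_at /= zR -zP rmorphM /= ratr_int.
  have -> : lin (\col_j z (i, Some j)) x = (map_mx ratr A *m x) i 0 * D%:~R.
    rewrite /lin mxE mulr_suml; apply: eq_bigr => j _.
    by rewrite !mxE zR -zP rmorphM /= ratr_int mulrAC.
  by rewrite ler_pM2r.
by apply/seteqP; split=> x /= H i; apply/row.
Qed.

Lemma rational_polyhedron_cuts (R : realType) n (l : seq ('cV[int]_n * int)) :
  rational_polyhedron [set x : 'cV[R]_n | forall s, s \in l -> holds_at x s].
Proof.
exists (size l), (\matrix_(i, j) ((l`_i).1 j 0)%:~R), (\col_i (l`_i).2%:~R).
have row x i : (map_mx ratr (\matrix_(i < size l, j < n) ((l`_i).1 j 0)%:~R) *m x) i 0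
    = lin (l`_i).1 x :> R.
  by rewrite mxE; apply: eq_bigr => j _; rewrite !mxE ratr_int.
apply/seteqP; split=> x /= H.
  by move=> i; rewrite row mxE ratr_int; apply: H; apply: mem_nth.
move=> s /(nthP 0) [i il <-]; have := H (Ordinal il).
by rewrite row mxE ratr_int.
Qed.

Lemma sum_option (V : nmodType) (T : finType) (F : option T -> V) :
  \sum_o F o = F None + \sum_i F (Some i).
Proof.
rewrite (bigD1 None) //=; congr (_ + _).
rewrite (reindex_omap Some id) => [|[]//].
by apply: eq_bigl => i; rewrite /= eqxx.
Qed.

Section Separation.
Variables (R : realType) (n : nat) (I : finType) (A : I -> 'cV[int]_n) (b : I -> int).
Local Notation aff := ('cV[int]_n * int)%type.
Let P : set 'cV[R]_n := [set x | forall i, holds_at x (A i, b i)].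

(** The rational system made of [A x <= b], [s.1 x >= s.2 + 1] and [g.1 x <= g.2] is infeasible. In
    a Farkas certificate the rows [A x <= b] alone combine to the half-space: it contains [P] and
    still contradicts the other two inequalities. *)
Lemma separation (s g : aff) :
  (forall p, homog A b p -> 0 < p.2 -> ev g p <= 0 -> ev s p < p.2) ->
  exists (a : 'cV[rat]_n) (beta : rat),
    forall x : 'cV[R]_n,
      (P x -> \sum_(i < n) ratr (a i 0) * x i 0 <= ratr beta) /\
      (\sum_(i < n) ratr (a i 0) * x i 0 <= ratr beta ->
        (s.2 + 1)%:~R <= lin s.1 x -> g.2%:~R < lin g.1 x).
Proof.
move=> sg.
pose a (o : option (option I)) : 'cV[int]_n := match o with
  | Some (Some i) => A i | Some None => - s.1 | None => g.1 end.
pose c (o : option (option I)) : int := match o with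
  | Some (Some i) => b i | Some None => - (s.2 + 1) | None => g.2 end.
have [x|lam [lam0 lama lamc]] := @farkas _ n _ (fun o => map_mx intr (a o) : 'cV[rat]_n)
    (fun o => (c o)%:~R).
  (* Clearing denominators turns the rational point into an integral point of the homogenization. *)
  have [D D0 [z0 zP]] := common_denominator (fun i => x i 0).
  pose z : 'cV[int]_n := \col_i z0 i.
  have linz (w : 'cV[int]_n) : (lin w z)%:~R =
      (\sum_j (map_mx intr w : 'cV[rat]_n) j 0 * x j 0) * D%:~R.
    rewrite -lin_intr /lin mulr_suml; apply: eq_bigr => j _.
    by rewrite !mxE -zP mulrA.
  have DR : 0 < D%:~R :> rat by rewrite ltr0z.
  have row o : (c o)%:~R < \sum_j (map_mx intr (a o) : 'cV[rat]_n) j 0 * x j 0 <->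
      c o * D < lin (a o) z.
    by rewrite -(ltr_int rat) linz intrM ltr_pM2r.
  apply: contrapT => /forallNP no.
  have {}no o : lin (a o) z <= c o * D.
    by rewrite leNgt; apply/negP => /row /no.
  have : ev s (z, D) < D.
    apply: (sg (z, D)) => //.
      split=> [|i]; first exact: ltW.
      by have := no (Some (Some i)); rewrite /ev /=; lia.
    by have := no None; rewrite /ev /=; lia.
  have := no (Some None); rewrite /ev /= -scaleN1r linZl intz.
  by move: (lin s.1 z) => L; lia.
have ratr_lin (w : 'cV[rat]_n) (l : rat) (v : 'cV[int]_n) (x : 'cV[R]_n) :
    \sum_(j < n) ratr ((l *: map_mx intr v) j 0) * x j 0 = ratr l * lin v x.
  by apply: ratr_form.
pose nrm := \sum_i lam (Some (Some i)) *: (map_mx intr (A i) : 'cV[rat]_n).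
pose rhs := \sum_i lam (Some (Some i)) * (b i)%:~R.
have nrmE (x : 'cV[R]_n) : \sum_(j < n) ratr (nrm j 0) * x j 0 =
    \sum_i ratr (lam (Some (Some i))) * lin (A i) x.
  under eq_bigr do rewrite /nrm summxE rmorph_sum mulr_suml.
  by rewrite exchange_big /=; apply: eq_bigr => i _; apply: ratr_lin.
have big_opt2 (V : zmodType) (F : option (option I) -> V) :
    \sum_o F o = F None + (F (Some None) + \sum_i F (Some (Some i))).
  by rewrite !sum_option.
exists nrm, rhs => x; split=> [Px|xH xs].
  rewrite nrmE /rhs rmorph_sum; apply: ler_sum => i _.
  rewrite rmorphM /= ratr_int ler_wpM2l ?ler0q //; exact: (Px i).
rewrite ltNge; apply/negP => xg.
have nu0 : 0 <= ratr (lam None) :> R by rewrite ler0q.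
have mu0 : 0 <= ratr (lam (Some None)) :> R by rewrite ler0q.
have zero : ratr (lam None) * lin g.1 x - ratr (lam (Some None)) * lin s.1 x +
    \sum_(j < n) ratr (nrm j 0) * x j 0 = 0.
  have : \sum_(j < n) ratr ((0 : 'cV[rat]_n) j 0) * x j 0 = 0 :> R.
    by rewrite big1 // => j _; rewrite mxE rmorph0 mul0r.
  rewrite -lama big_opt2 -/nrm; apply: etrans.
  rewrite -(ratr_lin 0 _ g.1) -(ratr_lin 0 _ s.1) -sumrN -!big_split /=.
  by apply: eq_bigr => j _; rewrite !mxE !rmorphD /= !rmorphM /= !ratr_int intrN; ring.
have neg : ratr (lam None) * g.2%:~R - ratr (lam (Some None)) * (s.2 + 1)%:~R +
    ratr rhs < 0 :> R.
  move: lamc; rewrite big_opt2 -/rhs -(ltrq0 R) /= intrN.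
  by rewrite !(rmorphD, rmorphM, rmorphN) /= ?rmorphD /= !ratr_int; lra.
have := ler_wpM2l nu0 xg; have := ler_wpM2l mu0 xs; lra.
Qed.

(** The normal given by [separation] may vanish; a full space is then replaced by a repetition of
    the other half-space. *)
Lemma closure_extended (S1 S2 : set 'cV[R]_n) x :
  two_halfspace_closure P x ->
  rational_halfspace S1 \/ S1 = setT -> rational_halfspace S2 \/ S2 = setT ->
  P `<=` S1 -> P `<=` S2 -> integer_hull (S1 `&` S2) x.
Proof.
move=> Tx [h1|->] [h2|->] P1 P2; last by rewrite setIT; apply: hull_setT.
- by apply: (Tx (S1, S2)); split=> //= y Py; split; [apply: P1|apply: P2].
- rewrite setIT -[S1]setIid.
  by apply: (Tx (S1, S1)); split=> //= y Py; split; apply: P1.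
- rewrite setTI -[S2]setIid.
  by apply: (Tx (S2, S2)); split=> //= y Py; split; apply: P2.
Qed.

(** The disjoint half-spaces where the first coordinate is at most 0 and at least 1 both contain the
    empty set. *)
Lemma empty_closure x : (0 < n)%N -> P = set0 -> ~ two_halfspace_closure P x.
Proof.
case: n A P x => // n' A' P' x _ P0 Tx.
have sumN (e : 'cV[rat]_n'.+1) (y : 'cV[R]_n'.+1) :
    \sum_i ratr ((- e) i 0) * y i 0 = - \sum_i ratr (e i 0) * y i 0.
  by rewrite -sumrN; apply: eq_bigr => i _; rewrite mxE rmorphN mulNr.
pose e : 'cV[rat]_n'.+1 := delta_mx 0 0.
have e0 : e != 0.
  by apply/eqP => /colP /(_ 0); rewrite !mxE !eqxx => /eqP; rewrite oner_eq0.
pose H1 := [set y : 'cV[R]_n'.+1 | \sum_i ratr (e i 0) * y i 0 <= ratr 0].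
pose H2 := [set y : 'cV[R]_n'.+1 | \sum_i ratr ((- e) i 0) * y i 0 <= ratr (- 1)].
have [|k [l [p [_ l1 Hp _]]]] := Tx (H1, H2).
  split=> /=; last by rewrite P0; apply: sub0set.
  - by exists e, 0.
  - by exists (- e), (- 1); rewrite oppr_eq0.
case: k l p l1 Hp => [|k] l p; first by rewrite big_ord0 => /esym/eqP; rewrite oner_eq0.
move=> _ /(_ 0) [[/= h1 h2] _]; move: h1 h2.
by rewrite /H1 /H2 /= sumN rmorphN /= rmorph0 rmorph1; lra.
Qed.

Lemma halfspace_or_full (a : 'cV[rat]_n) (beta : rat) (y : 'cV[R]_n)
    (H := [set x : 'cV[R]_n | \sum_(i < n) ratr (a i 0) * x i 0 <= ratr beta]) :
  H y -> rational_halfspace H \/ H = setT.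
Proof.
move=> Hy; have [a0|an0] := eqVneq a 0; last by left; exists a, beta.
have sum0 x : \sum_(i < n) ratr (a i 0) * x i 0 = 0 :> R.
  by rewrite big1 // => i _; rewrite a0 mxE rmorph0 mul0r.
right; apply/seteqP; split=> x // _; move: Hy.
by rewrite /H /= !sum0.
Qed.

(** Applying [separation] to each side of the strip gives two half-spaces around [P]. A lattice
    point in both that violates the cut would give [g.1] an integral value strictly between
    consecutive integers. *)
Lemma closure_holds_cut (s g : aff) x : (0 < n)%N ->
  valid_cut A b s g -> two_halfspace_closure P x -> holds_at x s.
Proof.
move=> n0 sg Tx.
have [P0|/set0P [y Py]] := eqVneq P set0; first by case: (empty_closure n0 P0 Tx).
pose g' : aff := (- g.1, - g.2 - 1).
have lin_g' (S : comPzRingType) (z : 'cV[S]_n) : lin g'.1 z = - lin g.1 z.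
  by rewrite /g' /= -scaleN1r linZl mulN1r.
have [a1 [b1 sep1]] : _ := separation (fun p hp p2 pg => sg p hp p2 (or_introl pg)).
have [p hp p2 pg'|a2 [b2 sep2]] := @separation s g'.
  apply: sg => //; right; move: pg'; rewrite /ev lin_g' /=.
  by move: (lin g.1 p.1) (g.2 : int) (p.2 : int) => L d N; lia.
have hull := closure_extended Tx
  (halfspace_or_full (proj1 (sep1 y) Py)) (halfspace_or_full (proj1 (sep2 y) Py))
  (fun z => proj1 (sep1 z)) (fun z => proj1 (sep2 z)).
apply: hull_le hull => z [/= /(proj2 (sep1 _)) h1 /(proj2 (sep2 _)) h2].
move: h1 h2; rewrite lin_g' !lin_intr -intrN !ler_int !ltr_int /=.
case: (lerP (lin s.1 z) s.2) => // sz; lia.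
Qed.

(** A good cut of the intersection of [H1] and [H2] is good for [P], because a point of the
    homogenization divided by its last coordinate is in [P]; then [hull_of_cuts] applies. *)
Lemma cuts_imply_closure x :
  (forall s g, valid_cut A b s g -> holds_at x s) -> two_halfspace_closure P x.
Proof.
move=> cuts [H1 H2] [/= h1 h2 PH]; apply: hull_of_cuts => // s g sg.
apply: (cuts s g) => p [_ pA] p2 pg; rewrite ltNge; apply/negP => ps.
have p2R : 0 < p.2%:~R :> R by rewrite ltr0z.
pose y : 'cV[R]_n := p.2%:~R^-1 *: map_mx intr p.1.
have liny (w : 'cV[int]_n) : lin w y = (lin w p.1)%:~R / p.2%:~R.
  by rewrite linZr lin_intr mulrC.
have Py : P y.
  move=> i; rewrite /holds_at /= liny ler_pdivrMr // -intrM ler_int.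
  by move: (pA i); rewrite /ev /=; lia.
have := sg y (PH y Py); rewrite !liny ler_pdivlMr // ltr_pdivlMr // ltr_pdivrMr //.
rewrite -!intrM ler_int !ltr_int => H; move: ps pg H; rewrite /ev.
by move=> ps pg /(_ ltac:(lia)) /andP [gl gr]; case: pg; lia.
Qed.

End Separation.

Theorem theorem1p3 (R : realType) (n : nat) (P : set 'cV[R]_n)
  (hP : rational_polyhedron P) :
  rational_polyhedron (two_halfspace_closure P).
Proof.
have [n0|n0] := posnP n.
  (* In dimension 0 every normal is zero, so there is no rational half-space and the closure is the
     whole space. *)
  have -> : two_halfspace_closure P = [set x | forall s, s \in [::] -> holds_at x s].
    apply/seteqP; split=> x // _ [H1 H2] [[a [beta [a0 _]]] _ _].
    by case/negP: a0; apply/eqP/colP => -[i i_n]; exfalso; rewrite n0 in i_n.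
  exact: rational_polyhedron_cuts.
have [I [A [b PE]]] := integral_description hP.
have [l [lP lcuts]] := cuts_finite A b.
have -> : two_halfspace_closure P = [set x | forall s, s \in l -> holds_at x s].
  rewrite PE; apply/seteqP; split=> x /=; first move=> Tx s /lP [g sg].
    exact: closure_holds_cut n0 sg Tx.
  move=> xl.
  by apply: cuts_imply_closure => s g sg; apply: lcuts sg _ _ xl.
exact: rational_polyhedron_cuts.
Qed.
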